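(* There is an absolute constant $C>0$ such that the following holds. Let $\varepsilon\in(0,1]$, and let an integer covering/packing program $\min\{c^Tx : x\in\mathbb{Z}_+^n,\ Ax\ge a,\ Bx\le b,\ x\le d\}$ be given, where $A\in\mathbb{R}_+^{m\times n}$, $B\in\mathbb{R}_+^{r\times n}$, $a\in\mathbb{R}_+^m$, $b\in\mathbb{R}_+^r$, $c,d\in\mathbb{R}_+^n$, together with a fractional solution $\bar{x}$. Let $\beta_i=\sum_j B_{ij}$. Then one can compute in polynomial time an $\hat{x}\in\mathbb{Z}_+^n$ such that (1) $c^T\hat{x}\le C\left(1+\frac{\ln(1+\alpha)}{W\varepsilon^2}\right)c^T\bar{x}$; (2) $A\hat{x}\ge A\bar{x}\ge a$; (3) $\hat{x}\le\lceil(1+\varepsilon)\bar{x}\rceil\le\lceil(1+\varepsilon)d\rceil$; (4) $B\hat{x}\le(1+\varepsilon)B\bar{x}+\beta\le(1+\varepsilon)b+\beta$.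
   Context: A fractional solution of the program is any $x\in\mathbb{R}_+^n$ with $Ax\ge a$, $Bx\le b$, $x\le d$. The width is $W=\min\{a_i/A_{ij} : A_{ij}>0\}$. The dilation $\alpha$ is the maximum, over variables $j$, of the number of covering constraints $i$ with $A_{ij}>0$. Ceilings of vectors are taken coordinatewise, and vector inequalities are coordinatewise. *)

(* Defs.v *)
From HB Require Import structures.
From mathcomp Require Import all_boot all_order all_algebra.
From mathcomp Require Import all_classical all_reals all_analysis.

Set Implicit Arguments.
Unset Strict Implicit.
Unset Printing Implicit Defensive.

Import Order.TTheory GRing.Theory Num.Theory.

Local Open Scope ring_scope.

Definition mxle (F : numDomainType) p q (A B : 'M[F]_(p, q)) : Prop :=
  forall i j, A i j <= B i j.

(* min { c^T x : x in Z_+^n, A x >= a, B x <= b, x <= d } *)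
Record cpip (F : Type) (m n r : nat) := CPIP {
  covmx  : 'M[F]_(m, n); (* A *)
  covrhs : 'cV[F]_m;     (* a *)
  packmx : 'M[F]_(r, n); (* B *)
  packrhs : 'cV[F]_r;    (* b *)
  costs  : 'cV[F]_n;     (* c *)
  mults  : 'cV[F]_n      (* d *)
}.

Definition map_cpip (F G : Type) (f : F -> G) m n r (P : cpip F m n r) :
    cpip G m n r :=
  CPIP (map_mx f (covmx P)) (map_mx f (covrhs P))
       (map_mx f (packmx P)) (map_mx f (packrhs P))
       (map_mx f (costs P)) (map_mx f (mults P)).

Section Program.
Variables (F : numDomainType) (m n r : nat).
Implicit Types (P : cpip F m n r) (x : 'cV[F]_n).

Definition nonneg_cpip P : Prop :=
  [/\ mxle 0 (covmx P), mxle 0 (packmx P) &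
   [/\ mxle 0 (covrhs P), mxle 0 (packrhs P),
       mxle 0 (costs P) & mxle 0 (mults P)]].

Definition fractional_solution P x : Prop :=
  [/\ mxle 0 x, mxle (covrhs P) (covmx P *m x),
      mxle (packmx P *m x) (packrhs P) & mxle x (mults P)].

Definition cost P x : F := ((costs P)^T *m x) 0 0.

Definition pack_rowsum P : 'cV[F]_r := \col_i \sum_j packmx P i j.

Definition dilation P : nat := \max_(j < n) #|[pred i | (0 < covmx P i j)%R]|.

Definition rounding_input P (eps : F) x : Prop :=
  [/\ 0 < eps <= 1, nonneg_cpip P & fractional_solution P x].

End Program.

Section Guarantee.
Variables (R : realType) (m n r : nat).
Implicit Types (P : cpip R m n r) (x : 'cV[R]_n).

(* The minimum over the empty set is +oo: this is the width when A = 0. *)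
Definition width P : \bar R :=
  \big[Order.min/+oo%E]_(ij : 'I_m * 'I_n | 0 < covmx P ij.1 ij.2)
    (covrhs P ij.1 0 / covmx P ij.1 ij.2)%:E.

Definition ceil_mx p q (M : 'M[R]_(p, q)) : 'M[int]_(p, q) := map_mx Num.ceil M.

(* The approximation factor is an extended real, with 1 / 0 = +oo and
   1 / +oo = 0. It is +oo when the width is 0, and it is C when A = 0. *)
Definition approx_factor (C : R) P (eps : R) : \bar R :=
  (C%:E * (1 + (ln (1 + (dilation P)%:R))%:E / (width P * (eps ^+ 2)%:E)))%E.

Definition rounding_guarantee (C : R) P (eps : R) x (xhat : 'cV[int]_n) : Prop :=
  let xh : 'cV[R]_n := map_mx intr xhat in
  mxle 0 xhat /\
  [/\ ((cost P xh)%:E <= approx_factor C P eps * (cost P x)%:E)%E,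
      mxle (covrhs P) (covmx P *m x)
      /\ mxle (covmx P *m x) (covmx P *m xh),
      mxle xhat (ceil_mx ((1 + eps) *: x))
      /\ mxle (ceil_mx ((1 + eps) *: x)) (ceil_mx ((1 + eps) *: mults P)) &
      mxle (packmx P *m xh) ((1 + eps) *: (packmx P *m x) + pack_rowsum P)
      /\ mxle ((1 + eps) *: (packmx P *m x) + pack_rowsum P)
              ((1 + eps) *: packrhs P + pack_rowsum P)].

End Guarantee.

(* Polynomial time is measured by a random access machine with logarithmic
   cost, equivalent to Turing machines up to a polynomial. Its cells, indexed
   by int, hold rationals; each operation is charged the bit lengths of the
   numerators and denominators of its operands and of its result. *)

Definition bitlen (k : nat) : nat := (trunc_log 2 k).+1.

Definition rat_size (q : rat) : nat := (bitlen `|numq q| + bitlen `|denq q|)%N.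

Definition memory : Type := int -> rat.

Definition update (M : memory) (k : int) (q : rat) : memory :=
  fun l => if l == k then q else M l.

Inductive expr : Type :=
| Const of rat
| Read of expr (* indirect: the address is the floor of the value *)
| Add of expr & expr
| Opp of expr
| Mul of expr & expr
| Inv of expr
| Floor of expr.

Fixpoint eval (M : memory) (e : expr) : rat :=
  match e with
  | Const q => q
  | Read e1 => M (Num.floor (eval M e1))
  | Add e1 e2 => eval M e1 + eval M e2
  | Opp e1 => - eval M e1
  | Mul e1 e2 => eval M e1 * eval M e2
  | Inv e1 => (eval M e1)^-1
  | Floor e1 => (Num.floor (eval M e1))%:~R
  end.

Fixpoint eval_cost (M : memory) (e : expr) : nat :=
  (rat_size (eval M e) +
   match e with
   | Const _ => 0
   | Read e1 | Opp e1 | Inv e1 | Floor e1 => eval_cost M e1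
   | Add e1 e2 | Mul e1 e2 => eval_cost M e1 + eval_cost M e2
   end)%N.

Inductive cmd : Type :=
| Skip
| Write of expr & expr (* Write e1 e2 writes e2 at the address floor e1 *)
| Seq of cmd & cmd
| IfPos of expr & cmd & cmd
| WhilePos of expr & cmd.

(* exec p M t M': from memory M, p halts in memory M' with total cost t. *)
Inductive exec : cmd -> memory -> nat -> memory -> Prop :=
| ExecSkip M : exec Skip M 1%N M
| ExecWrite e1 e2 M :
    exec (Write e1 e2) M (1 + eval_cost M e1 + eval_cost M e2)%N
      (update M (Num.floor (eval M e1)) (eval M e2))
| ExecSeq p1 p2 M M1 M2 t1 t2 :
    exec p1 M t1 M1 -> exec p2 M1 t2 M2 ->
    exec (Seq p1 p2) M (1 + t1 + t2)%N M2
| ExecIfTrue e p1 p2 M M' t :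
    0 < eval M e -> exec p1 M t M' ->
    exec (IfPos e p1 p2) M (1 + eval_cost M e + t)%N M'
| ExecIfFalse e p1 p2 M M' t :
    eval M e <= 0 -> exec p2 M t M' ->
    exec (IfPos e p1 p2) M (1 + eval_cost M e + t)%N M'
| ExecWhileTrue e p M M1 M2 t1 t2 :
    0 < eval M e -> exec p M t1 M1 -> exec (WhilePos e p) M1 t2 M2 ->
    exec (WhilePos e p) M (1 + eval_cost M e + t1 + t2)%N M2
| ExecWhileFalse e p M :
    eval M e <= 0 -> exec (WhilePos e p) M (1 + eval_cost M e)%N M.

(* The input word occupies the cells 0, 1, 2, ...; all other cells hold 0. *)
Definition load (s : seq rat) : memory :=
  fun k => if k is Posz i then nth 0 s i else 0.

Definition input_size (s : seq rat) : nat := (\sum_(q <- s) rat_size q)%N.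

(* row-major *)
Definition mx_entries p q (M : 'M[rat]_(p, q)) : seq rat :=
  [seq M i j | i <- enum 'I_p, j <- enum 'I_q].

Definition encode_input m n r (P : cpip rat m n r) (eps : rat)
    (x : 'cV[rat]_n) : seq rat :=
  [:: m%:R; n%:R; r%:R; eps]
  ++ mx_entries (covmx P) ++ mx_entries (covrhs P)
  ++ mx_entries (packmx P) ++ mx_entries (packrhs P)
  ++ mx_entries (costs P) ++ mx_entries (mults P) ++ mx_entries x.

Definition holds_output n (M : memory) (x : 'cV[int]_n) : Prop :=
  forall j : 'I_n, M (Posz j) = (x j 0)%:~R.

(* Main.v *)
(** By (3), [xhat <= (1 + eps) xbar + 1], and (4) follows by multiplying with
    [B]; so only the covering constraints, the bounds (3) and the cost matter.

    Put [fl = floor ((1 + eps) xbar)] and let [y] be the fractional part. We look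
    for a 0/1 vector [z], supported where [y > 0], such that [fl + z] covers
    [A xbar]; for row [i] this asks [A z >= A y - eps A xbar], so there is a slack
    of [eps (A xbar)_i], while an entry of the row is at most [(A xbar)_i / W].
    Let [N] bound the column counts, [H = 1 + 1/2 + ... + 1/N] (between
    [ln (1 + N)] and [2 ln (1 + N)]) and [lam = 1 + 8 H / (W eps^2)].

    If [z_j] is drawn with probability [min (1, lam y_j)], a Chernoff bound shows
    that row [i] fails with probability at most [1 / (1 + N)]. A failed row is
    repaired by a greedy knapsack rounding, at cost at most [lam] times the part of
    [c y] carried by the row. Since every column meets at most [N] rows, the
    expected total cost is at most [2 lam c y]. Conditional expectations remove the
    randomness; the pessimistic estimator is
    [c w + sum_i g_i prod_k (1 - u_ik w_k)], a multi-affine function of [w] with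
    rational coefficients, where [g_i] is the repair cost of row [i] divided by
    [(1 + N)] times the initial value of its product. No exponential is evaluated.

    For the running time, quantities built from the input by arithmetic and by
    sums, products and maxima over rows or columns have bit length and evaluation
    time polynomial in the input size, and the algorithm consists of two passes
    over the variables that evaluate such quantities. *)
From Pilot Require Import Defs.
From mathcomp Require Import all_boot all_order all_algebra.
From mathcomp Require Import all_classical all_reals all_analysis.
From mathcomp Require Import zify ring lra.
Import Pilot.Defs.
Import Order.TTheory GRing.Theory Num.Theory.
Local Open Scope ring_scope.

Set Implicit Arguments.
Unset Strict Implicit.
Unset Printing Implicit Defensive.

(** * Bit lengths and counted loops *)

(** Numerator and denominator of the reduced fraction have at most [b] bits. Unlike the sum
    [rat_size], this form is carried through each field operation by a simple law. *)
Definition height_le (b : nat) (q : rat) : bool :=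
  (`|numq q| < 2 ^ b)%N && (`|denq q| < 2 ^ b)%N.

Lemma height_le_gt0 b q : height_le b q -> (0 < b)%N.
Proof. by case: b => // /andP[_]; have := denq_gt0 q; lia. Qed.

Lemma height_leW a b q : (a <= b)%N -> height_le a q -> height_le b q.
Proof.
move=> ab /andP[h1 h2]; apply/andP; split; apply: leq_trans (_ : 2 ^ a <= _)%N => //;
  by rewrite leq_exp2l.
Qed.

(** Cancelling a common factor only shrinks both parts, so any fraction representing a number bounds
    its height. *)
Lemma height_le_frac b (n d : int) : d != 0 ->
  (`|n| < 2 ^ b)%N -> (`|d| < 2 ^ b)%N -> height_le b (n%:~R / d%:~R).
Proof.
case: divqP => [//|k x k0 d0 hn hd]; apply/andP; split.
- by apply: leq_ltn_trans hn; rewrite abszM leq_pmull // absz_gt0.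
- by apply: leq_ltn_trans hd; rewrite abszM leq_pmull // absz_gt0.
Qed.

Lemma height_leM a b x y :
  height_le a x -> height_le b y -> height_le (a + b) (x * y).
Proof.
move=> /andP[xn xd] /andP[yn yd].
rewrite -[x]divq_num_den -[y]divq_num_den mulf_div -!intrM.
apply: height_le_frac; first by rewrite mulf_neq0 ?denq_neq0.
- by rewrite abszM expnD ltn_mul.
- by rewrite abszM expnD ltn_mul.
Qed.

Lemma height_leD a b x y :
  height_le a x -> height_le b y -> height_le (a + b).+1 (x + y).
Proof.
move=> /andP[xn xd] /andP[yn yd].
rewrite -[x]divq_num_den -[y]divq_num_den addf_div ?intr_eq0 ?denq_neq0 //.
rewrite -!intrM -intrD.
apply: height_le_frac; first by rewrite mulf_neq0 ?denq_neq0.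
- have h1 : (`|(numq x * denq y)%R| < 2 ^ (a + b))%N by rewrite abszM expnD ltn_mul.
  have h2 : (`|(numq y * denq x)%R| < 2 ^ (a + b))%N
    by rewrite abszM addnC expnD ltn_mul.
  by rewrite expnS; lia.
- by apply: ltn_trans (_ : 2 ^ (a + b) < _)%N; rewrite ?ltn_exp2l // abszM expnD ltn_mul.
Qed.

Lemma height_leN a x : height_le a (- x) = height_le a x.
Proof. by rewrite /height_le numqN denqN abszN. Qed.

Lemma height_leV a x : height_le a x -> height_le a x^-1.
Proof.
have [->|x0] := eqVneq x 0; first by rewrite invr0.
move=> /andP[xn xd]; rewrite -[x]divq_num_den invf_div.
by apply: height_le_frac => //; rewrite numq_eq0.
Qed.

Lemma height_le_int b (z : int) : (`|z| < 2 ^ b)%N -> (0 < b)%N -> height_le b z%:~R.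
Proof.
move=> zb b0; rewrite /height_le numq_int denq_int zb /=.
by rewrite -(expn0 2) ltn_exp2l.
Qed.

Lemma height_le_nat b k : (k <= b)%N -> height_le b.+1 k%:R.
Proof.
move=> kb; rewrite -[k%:R]/((Posz k)%:~R); apply: height_le_int => //=.
by apply: leq_ltn_trans kb _; apply: ltn_trans (ltnSn b) _; apply: ltn_expl.
Qed.

(** The denominator is at least 1, so [x] lies between the integers plus and minus [|numq x|], and
    hence so does its floor. *)
Lemma height_le_floor a x : height_le a x -> height_le a (Num.floor x)%:~R.
Proof.
move=> ha; apply: height_le_int; last exact: height_le_gt0 ha.
case/andP: ha => xn _; apply: leq_ltn_trans xn.
have nx : `|x| <= (`|numq x|%N)%:R.
  rewrite -[(`|numq x|%N)%:R]/((Posz `|numq x|%N)%:~R) abszE.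
  rewrite -{1}[x]divq_num_den normrM normfV -!intr_norm -[leRHS]mulr1.
  rewrite ler_wpM2l ?ler0z // invf_le1; first by rewrite ler1z normr_denq; have := denq_gt0 x; lia.
  by rewrite ltr0z normr_gt0 denq_neq0.
have h1 : (Num.floor x)%:~R <= (`|numq x|%N)%:R :> rat.
  by apply: le_trans (floor_le x) _; apply: le_trans nx; apply: ler_norm.
have h2 : - (Posz `|numq x|%N) <= Num.floor x.
  rewrite floor_ge_int rmorphN /= lerNl; apply: le_trans nx.
  by rewrite -normrN ler_norm.
have h3 : Num.floor x <= Posz `|numq x|%N by rewrite -(ler_int rat).
by lia.
Qed.

Lemma rat_size_height b q : height_le b q -> (rat_size q <= b + b)%N.
Proof.
move=> hq; have b0 := height_le_gt0 hq; case/andP: hq => hn hd.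
have bl k : (k < 2 ^ b)%N -> (bitlen k <= b)%N.
  case: k => [|k] kb; first by rewrite /bitlen trunc_log0.
  by rewrite /bitlen -(ltn_exp2l _ _ (isT : 1 < 2)%N); apply: leq_ltn_trans kb; apply: trunc_logP.
by rewrite leq_add ?bl.
Qed.

Lemma height_rat_size q b : (rat_size q <= b)%N -> height_le b q.
Proof.
rewrite /rat_size /bitlen => hb; apply/andP; split;
 by apply: leq_trans (trunc_log_ltn _ (isT : 1 < 2)%N) _; rewrite leq_exp2l //; lia.
Qed.

Lemma rat_size_nat k b : (k <= b)%N -> (rat_size k%:R <= b.+1 + b.+1)%N.
Proof. by move=> kb; apply: rat_size_height; apply: height_le_nat. Qed.

Lemma rat_size_int (z : int) b : (`|z| <= b)%N -> (rat_size z%:~R <= b.+1 + b.+1)%N.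
Proof.
move=> kb; apply: rat_size_height; apply: height_le_int => //.
by apply: leq_ltn_trans kb _; apply: ltn_trans (ltnSn b) _; apply: ltn_expl.
Qed.

Lemma rat_sizeN x : rat_size (- x) = rat_size x.
Proof. by rewrite /rat_size numqN denqN abszN. Qed.

(** Replaces every size of an integer of absolute value at most [K] by a fresh variable with a
    linear bound, which leaves a goal for [lia]. Bounding a bit length by the number itself is
    wasteful but still polynomial here. *)
Ltac bound_sizes K :=
  repeat match goal with
  | |- context [rat_size ?x] =>
      let h := fresh "h" in let n := fresh "n" in
      have h : (rat_size x <= K.+1 + K.+1)%N
        by [apply: rat_size_nat | apply: rat_size_int];
      revert h; generalize (rat_size x); intros n h
  end.

(** A single power of [S + 2] replaces a polynomial: the base is at least 2, so constants and sums
    are absorbed by raising the exponent. *)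
Definition poly_bounded (f : nat -> nat) : Prop :=
  exists c, forall S, (f S <= (S + 2) ^ c)%N.

Lemma poly_bounded_const c : poly_bounded (fun=> c).
Proof.
exists c => S; apply: leq_trans (_ : 2 ^ c <= _)%N; first exact/ltnW/ltn_expl.
by case: c => // c; rewrite leq_exp2r // leq_addl.
Qed.

Lemma poly_bounded_id : poly_bounded id.
Proof. by exists 1%N => S; rewrite expn1 leq_addr. Qed.

Lemma poly_bounded_add f g : poly_bounded f -> poly_bounded g ->
  poly_bounded (fun S => f S + g S)%N.
Proof.
move=> [a fa] [b gb]; exists (a + b).+1 => S.
have e : (2 * (S + 2) ^ (a + b) <= (S + 2) ^ (a + b).+1)%N.
  by rewrite expnS leq_mul2r leq_addl orbT.
apply: leq_trans e; rewrite mul2n -addnn leq_add //.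
- by apply: leq_trans (fa S) _; rewrite leq_exp2l ?leq_addr ?addn2.
- by apply: leq_trans (gb S) _; rewrite leq_exp2l ?leq_addl ?addn2.
Qed.

Lemma poly_bounded_mul f g : poly_bounded f -> poly_bounded g ->
  poly_bounded (fun S => f S * g S)%N.
Proof.
move=> [a fa] [b gb]; exists (a + b)%N => S.
by rewrite expnD leq_mul.
Qed.

(** * Memory updates and the counted loop *)

Lemma updateE M k q : update M k q k = q.
Proof. by rewrite /update eqxx. Qed.

Lemma updateN M k q l : l != k -> update M k q l = M l.
Proof. by rewrite /update => /negbTE ->. Qed.

Definition cell (a : int) : expr := Read (Const a%:~R).

Lemma eval_cell M a : eval M (cell a) = M a.
Proof. by rewrite /= intrKfloor. Qed.

Lemma exec_write_const M (a : int) e :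
  exec (Write (Const a%:~R) e) M (1 + (rat_size (a%:~R) + 0) + eval_cost M e)
    (update M a (eval M e)).
Proof. by have := ExecWrite (Const a%:~R) e M; rewrite /= intrKfloor. Qed.

Definition for_loop (v b : int) (body : cmd) : cmd :=
  Seq (Write (Const v%:~R) (Const 0))
    (WhilePos (Add (cell b) (Opp (cell v)))
       (Seq body (Write (Const v%:~R) (Add (cell v) (Const 1))))).

(** [J k] is the loop invariant when the counter holds [k]; the body must leave the counter alone
    and establish [J k.+1] for the memory after the increment. The term with 40 pays for one guard
    and one increment. *)
Lemma for_loop_exec (v b : int) (N : nat) (body : cmd) (tau : nat)
    (J : nat -> memory -> Prop) (M : memory) :
  (forall k M, J k M -> M v = k%:R /\ M b = N%:R) ->
  (forall k M, (k < N)%N -> J k M -> exists t M',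
     [/\ exec body M t M', (t <= tau)%N, M' v = k%:R &
         J k.+1 (update M' v k.+1%:R)]) ->
  J 0%N (update M v 0) ->
  exists t M', [/\ exec (for_loop v b body) M t M',
    (t <= N.+1 * (tau + 40 * (N + `|v| + `|b| + 2)))%N & J N M'].
Proof.
move=> HJ Hbody J0.
set K := (N + `|v| + `|b|)%N.
have guard k M1 : (k <= N)%N -> J k M1 ->
    eval M1 (Add (cell b) (Opp (cell v))) = (N - k)%:R /\
    (eval_cost M1 (Add (cell b) (Opp (cell v))) <= 12 * K.+1)%N.
  move=> kN /HJ [hv hb]; rewrite /= !intrKfloor hv hb natrB //; split => //.
  rewrite -natrB // rat_sizeN.
  have Kv : (`|v| <= K)%N by rewrite /K; lia.
  have Kb : (`|b| <= K)%N by rewrite /K; lia.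
  have KN : (N <= K)%N by rewrite /K; lia.
  have Kk : (k <= K)%N by rewrite /K; lia.
  have Kd : (N - k <= K)%N by rewrite /K; lia.
  clearbody K; bound_sizes K; lia.
(* Induction on the number [d] of rounds left; the last summands of the bound pay for the guard that
   fails. *)
have loop : forall d k M1, (k + d = N)%N -> J k M1 -> exists t M',
   [/\ exec (WhilePos (Add (cell b) (Opp (cell v)))
       (Seq body (Write (Const v%:~R) (Add (cell v) (Const 1))))) M1 t M',
      (t <= d * (tau + 40 * (K + 2)) + 12 * K.+1 + 1)%N & J N M'].
  elim=> [|d IH] k M1 kd Jk.
    have kN : k = N by lia.
    have [gv gc] := guard k M1 ltac:(lia) Jk.
    exists (1 + eval_cost M1 (Add (cell b) (Opp (cell v))))%N, M1; split.
    - by apply: ExecWhileFalse; rewrite gv kN subnn.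
    - by lia.
    - by rewrite -kN.
  have [gv gc] := guard k M1 ltac:(lia) Jk.
  have [t [M2 [e2 t2 v2 J2]]] := Hbody k M1 ltac:(lia) Jk.
  have ew := exec_write_const M2 v (Add (cell v) (Const 1)).
  have ev : eval M2 (Add (cell v) (Const 1)) = k.+1%:R
    by rewrite /= intrKfloor v2 -natr1.
  rewrite ev in ew.
  have [t' [M' [e' t'b J']]] := IH k.+1 _ ltac:(lia) J2.
  eexists; exists M'; split; last exact: J'.
  - by apply: ExecWhileTrue (ExecSeq e2 ew) e'; rewrite gv ltr0n; lia.
  - have ecb : (eval_cost M2 (Add (cell v) (Const 1)) <= 8 * (K + 2))%N.
      rewrite /= !intrKfloor v2 natr1.
      have Kk : (k.+1 <= K.+1)%N by rewrite /K; lia.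
      have Kk' : (k <= K.+1)%N by rewrite /K; lia.
      have Kv : (`|v| <= K.+1)%N by rewrite /K; lia.
      rewrite (_ : rat_size 1 = 2)%N //; clearbody K; bound_sizes K.+1; lia.
    have Kv : (`|v| <= K)%N by rewrite /K; lia.
    move: ecb gc t2 t'b; rewrite -/K (mulSn d).
    move: (eval_cost _ _) (eval_cost _ _) (d * _)%N => x y dd.
    clearbody K; bound_sizes K; lia.
have [t [M' [e tb JN]]] := loop N 0%N _ (add0n N) J0.
eexists; exists M'; split; last exact: JN.
- have := exec_write_const M v (Const 0); rewrite [eval _ _]/= => ew.
  exact: ExecSeq ew e.
- have Kv : (`|v| <= K)%N by rewrite /K; lia.
  move: tb; rewrite -/K (mulSn N) [eval_cost _ _]/=.
  rewrite (_ : rat_size 0 = 2)%N //.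
  move: (N * _)%N => dd; clearbody K; bound_sizes K; lia.
Qed.

(** * Expressions computable in polynomial time *)

#[local] Hint Resolve poly_bounded_const poly_bounded_id
  poly_bounded_add poly_bounded_mul : pbdd.

(* Negative addresses modulo 4: loop variables, temporaries, the 0/1 vector, and
   a buffer for the result, which is copied over the input only at the end. *)
Definition vcell (l : nat) : int := Negz (4 * l).
Definition tcell (l : nat) : int := Negz (4 * l + 1).
Definition zcell (l : nat) : int := Negz (4 * l + 2).
Definition ycell (l : nat) : int := Negz (4 * l + 3).

(** The part of the memory that expressions may read: the input word and the 0/1 vector under
    construction. *)
Record ctx := Ctx { inp : nat -> rat; zval : nat -> rat }.

Definition count_of (c : nat) (s : ctx) : nat := `|numq (inp s c)|%N.

(** The three dimensions are bounded by [S] in value, since loops run that often; everything else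
    only in bit length. *)
Definition ctx_le (S : nat) (s : ctx) : Prop :=
  [/\ forall c, (c < 3)%N -> inp s c = (count_of c s)%:R /\ (count_of c s <= S)%N,
      forall k, height_le S (inp s k) & forall k, height_le S (zval s k)].

(** [vs] lists the current values of the enclosing loop variables, innermost first, and [rs] the
    registers that hold them. *)
Definition env_rep (s : ctx) (rs vs : seq nat) (M : memory) : Prop :=
  [/\ forall k : nat, M k%:Z = inp s k, forall k, M (zcell k) = zval s k &
      forall i, (i < size rs)%N -> M (vcell (nth 0%N rs i)) = (nth 0%N vs i)%:R].

Definition env_ok (S dv : nat) (s : ctx) (vs : seq nat) : Prop :=
  [/\ ctx_le S s, size vs = dv & all (leq^~ S) vs].

(** A stack discipline: evaluation may overwrite only loop registers from [dv] on and temporaries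
    from [dt] on, so values kept below these marks survive nested evaluations. *)
Definition frame (dv dt : nat) (M M' : memory) : Prop :=
  forall k, (forall l, (dv <= l)%N -> k != vcell l) ->
    (forall l, (dt <= l)%N -> k != tcell l) -> M' k = M k.

(* A loop variable is the head of vs, and rs names the register that holds it;
   quantifying over rs and over the scratch registers is what makes the
   predicate stable under weakening. *)
Definition computable (dv : nat) (f : ctx -> seq nat -> rat) : Prop :=
  exists sigma, [/\ poly_bounded sigma,
    forall S s vs, env_ok S dv s vs -> height_le (sigma S) (f s vs) &
    forall rs dv' dt, size rs = dv -> all (ltn^~ dv') rs ->
    exists p tau, poly_bounded tau /\
    forall S s vs M, env_ok S dv s vs -> env_rep s rs vs M ->
    exists t M', [/\ exec p M t M', (t <= tau S)%N, M' (tcell dt) = f s vs &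
                     frame dv' dt M M']].

Lemma frame_trans dv dt M1 M2 M3 :
  frame dv dt M1 M2 -> frame dv dt M2 M3 -> frame dv dt M1 M3.
Proof. by move=> f g k hv ht; rewrite g // f. Qed.

Lemma frameW dv dt dv' dt' M1 M2 : (dv' <= dv)%N -> (dt' <= dt)%N ->
  frame dv dt M1 M2 -> frame dv' dt' M1 M2.
Proof.
move=> hv ht f k h1 h2; apply: f => l hl; [apply: h1|apply: h2]; lia.
Qed.

Lemma frame_update_t dv dt M l q : (dt <= l)%N -> frame dv dt M (update M (tcell l) q).
Proof. by move=> hl k h1 h2; rewrite updateN // h2. Qed.

Lemma frame_update_v dv dt M l q : (dv <= l)%N -> frame dv dt M (update M (vcell l) q).
Proof. by move=> hl k h1 h2; rewrite updateN // h1. Qed.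

Lemma vcell_neq l k : l != k -> vcell l != vcell k.
Proof. by move=> lk; apply/eqP => -[]; lia. Qed.

Lemma tcell_neq l k : l != k -> tcell l != tcell k.
Proof. by move=> lk; apply/eqP => -[]; lia. Qed.

Lemma vtcell l k : vcell l != tcell k.
Proof. by apply/eqP => -[]; lia. Qed.

Lemma tvcell l k : tcell l != vcell k.
Proof. by apply/eqP => -[]; lia. Qed.

Lemma frame_t dv dt M M' l : frame dv dt M M' -> (l < dt)%N ->
  M' (tcell l) = M (tcell l).
Proof.
move=> f hl; apply: f => k hk; first exact: tvcell.
by apply: tcell_neq; lia.
Qed.

Lemma frame_v dv dt M M' l : frame dv dt M M' -> (l < dv)%N ->
  M' (vcell l) = M (vcell l).
Proof.
move=> f hl; apply: f => k hk; last exact: vtcell.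
by apply: vcell_neq; lia.
Qed.

Lemma frame_pos dv dt M M' (k : nat) : frame dv dt M M' -> M' k%:Z = M k%:Z.
Proof. by move=> f; apply: f. Qed.

Lemma frame_z dv dt M M' k : frame dv dt M M' -> M' (zcell k) = M (zcell k).
Proof. by move=> f; apply: f => l _; apply/eqP => -[]; lia. Qed.

Lemma frame_y dv dt M M' k : frame dv dt M M' -> M' (ycell k) = M (ycell k).
Proof. by move=> f; apply: f => l _; apply/eqP => -[]; lia. Qed.

Lemma env_rep_frame s rs vs dv dt M M' : all (ltn^~ dv) rs ->
  frame dv dt M M' -> env_rep s rs vs M -> env_rep s rs vs M'.
Proof.
move=> hrs f [h1 h2 h3]; split=> [k|k|i hi].
- by rewrite (frame_pos _ f) h1.
- by rewrite (frame_z _ f) h2.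
- by rewrite (frame_v f) ?h3 //; apply: (allP hrs); apply: mem_nth.
Qed.

(** * Arithmetic on memory cells and closure of computable expressions *)

Definition unary (op : rat -> rat) : Prop :=
  (forall b x, height_le b x -> height_le b.+1 (op x)) /\
  forall a : int, exists p K, forall M b, height_le b (M a) -> exists t,
    exec p M t (update M a (op (M a))) /\ (t <= K + 10 * b)%N.

(** The result replaces the first operand, as an accumulator needs. The height grows by addition and
    not by doubling, so that a fold over polynomially many terms keeps a polynomial bit length. *)
Definition binary (op : rat -> rat -> rat) : Prop :=
  (forall a b x y, height_le a x -> height_le b y ->
     height_le (a + b).+1 (op x y)) /\
  forall a a' : int, a != a' -> exists p K, forall M b,
    height_le b (M a) -> height_le b (M a') -> exists t M',
    [/\ exec p M t M', M' a = op (M a) (M a'), (t <= K + 20 * b)%N &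
        forall k, k != a -> M' k = M k].

Lemma unary_expr (e : expr -> expr) (op : rat -> rat) :
  (forall b x, height_le b x -> height_le b.+1 (op x)) ->
  (forall M e0, eval M (e e0) = op (eval M e0)) ->
  (forall M e0, eval_cost M (e e0) = (rat_size (op (eval M e0)) + eval_cost M e0)%N) ->
  unary op.
Proof.
move=> hop hev hco; split=> // a.
exists (Write (Const a%:~R) (e (cell a))), (10 + 10 * `|a|)%N => M b hb.
eexists; split.
  have := exec_write_const M a (e (cell a)); rewrite hev eval_cell => H; exact: H.
rewrite hco eval_cell [eval_cost _ _]/= intrKfloor.
have := rat_size_height hb; have := rat_size_height (hop _ _ hb).
have := @rat_size_int a `|a| (leqnn _); lia.
Qed.

Lemma unary_opp : unary -%R.
Proof.
apply: (@unary_expr Opp) => // b x hx; rewrite height_leN.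
exact: height_leW hx.
Qed.

Lemma unary_inv : unary GRing.inv.
Proof.
apply: (@unary_expr Inv) => // b x hx; apply: height_leV.
exact: height_leW hx.
Qed.

Lemma unary_floor : unary (fun x => (Num.floor x)%:~R).
Proof.
apply: (@unary_expr Floor) => // b x hx; apply: height_le_floor.
exact: height_leW hx.
Qed.

Lemma binary_expr (e : expr -> expr -> expr) (op : rat -> rat -> rat) :
  (forall a b x y, height_le a x -> height_le b y ->
     height_le (a + b).+1 (op x y)) ->
  (forall M e0 e1, eval M (e e0 e1) = op (eval M e0) (eval M e1)) ->
  (forall M e0 e1, eval_cost M (e e0 e1) =
     (rat_size (op (eval M e0) (eval M e1)) + (eval_cost M e0 + eval_cost M e1))%N) ->
  binary op.
Proof.
move=> hop hev hco; split=> // a a' aa'.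
exists (Write (Const a%:~R) (e (cell a) (cell a'))), (20 + 10 * (`|a| + `|a'|))%N => M b hb hb'.
eexists; eexists; split.
- have := exec_write_const M a (e (cell a) (cell a')); rewrite hev !eval_cell => H; exact: H.
- by rewrite updateE.
- rewrite hco !eval_cell [eval_cost _ _]/= [X in (_ + X)%N]/= !intrKfloor.
  have := rat_size_height hb; have := rat_size_height hb'.
  have := rat_size_height (hop _ _ _ _ hb hb').
  have := @rat_size_int a `|a| (leqnn _); have := @rat_size_int a' `|a'| (leqnn _); lia.
- by move=> k ka; rewrite updateN.
Qed.

Lemma binary_add : binary +%R.
Proof. by apply: (@binary_expr Add) => // a b x y; apply: height_leD. Qed.

Lemma binary_mul : binary *%R.
Proof.
apply: (@binary_expr Mul) => // a b x y hx hy; apply: height_leW (height_leM hx hy).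
by [].
Qed.

(** The comparison is phrased as a sign test because that is the only test of the machine. *)
Definition max2 (F : numDomainType) (x y : F) : F := if 0 < x - y then x else y.

Lemma binary_max : binary (@max2 _).
Proof.
split=> [a b x y hx hy|a a' aa'].
  by rewrite /max2; case: ifP => _; [apply: height_leW hx|apply: height_leW hy]; lia.
exists (IfPos (Add (cell a) (Opp (cell a'))) Skip (Write (Const a%:~R) (cell a'))).
exists (60 + 20 * (`|a| + `|a'|))%N => M b hb hb'.
have hN : height_le b (- M a') by rewrite height_leN.
have gc : (eval_cost M (Add (cell a) (Opp (cell a'))) <=
    20 + 10 * (`|a| + `|a'|) + 14 * b)%N.
  rewrite /= !intrKfloor.
  have := rat_size_height hb; have := rat_size_height hb'.
  have := rat_size_height hN; have := rat_size_height (height_leD hb hN).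
  have := @rat_size_int a `|a| (leqnn _); have := @rat_size_int a' `|a'| (leqnn _); lia.
have ge : eval M (Add (cell a) (Opp (cell a'))) = M a - M a' by rewrite /= !intrKfloor.
rewrite /max2; case: ltP => h.
- do 2!eexists; split; first by apply: ExecIfTrue (ExecSkip _); rewrite ge.
  + by [].
  + by lia.
  + by [].
- do 2!eexists; split.
  + by apply: ExecIfFalse (exec_write_const M a (cell a')); rewrite ge.
  + by rewrite updateE eval_cell.
  + rewrite [eval_cost _ (cell _)]/= intrKfloor.
    have := rat_size_height hb'; have := @rat_size_int a' `|a'| (leqnn _).
    have := @rat_size_int a `|a| (leqnn _); lia.
  + by move=> k ka; rewrite updateN.
Qed.

Lemma computable_unary op dv f : unary op -> computable dv f ->
  computable dv (fun s vs => op (f s vs)).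
Proof.
move=> [hop pop] [sg [sgp sgb pf]].
exists (fun S => sg S + 1)%N; split=> [|S s vs ok|rs dv' dt srs lrs].
- by auto with pbdd.
- by rewrite addn1; apply/hop/sgb.
have [p [tau [taup hp]]] := pf rs dv' dt srs lrs.
have [q [K hq]] := pop (tcell dt).
exists (Seq p q), (fun S => 1 + tau S + (K + 10 * sg S))%N; split; first by auto with pbdd.
move=> S s vs M ok rep.
have [t [M' [e et ev fr]]] := hp S s vs M ok rep.
have [t' [e' et']] := hq M' (sg S) ltac:(rewrite ev; exact: sgb).
do 2!eexists; split; first exact: ExecSeq e e'.
- by lia.
- by rewrite updateE ev.
- by apply: frame_trans fr _; apply: frame_update_t.
Qed.

Lemma computable_binary op dv f g : binary op -> computable dv f -> computable dv g ->
  computable dv (fun s vs => op (f s vs) (g s vs)).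
Proof.
move=> [hop pop] [sf [sfp sfb pf]] [sg [sgp sgb pg]].
exists (fun S => sf S + sg S + 1)%N; split=> [|S s vs ok|rs dv' dt srs lrs].
- by auto with pbdd.
- by rewrite addn1; apply: hop; [apply: sfb|apply: sgb].
have [p [tau [taup hp]]] := pf rs dv' dt srs lrs.
have [p' [tau' [taup' hp']]] := pg rs dv' dt.+1 srs lrs.
have [q [K hq]] := pop (tcell dt) (tcell dt.+1) ltac:(apply: tcell_neq; lia).
exists (Seq p (Seq p' q)), (fun S => 2 + tau S + tau' S + (K + 20 * (sf S + sg S)))%N.
split; first by auto 10 with pbdd.
move=> S s vs M ok rep.
have [t [M1 [e et ev fr]]] := hp S s vs M ok rep.
have rep1 := env_rep_frame lrs fr rep.
have [t' [M2 [e' et' ev' fr']]] := hp' S s vs M1 ok rep1.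
have ev2 : M2 (tcell dt) = f s vs by rewrite (frame_t fr').
have h1 : height_le (sf S + sg S) (M2 (tcell dt))
  by rewrite ev2; apply: height_leW (sfb S s vs ok); lia.
have h2 : height_le (sf S + sg S) (M2 (tcell dt.+1))
  by rewrite ev'; apply: height_leW (sgb S s vs ok); lia.
have [t2 [M3 [e2 ev3 et2 fr2]]] := hq M2 _ h1 h2.
do 2!eexists; split; first exact: ExecSeq e (ExecSeq e' e2).
- by lia.
- by rewrite ev3 ev2 ev'.
- apply: frame_trans fr _; apply: frame_trans (frameW _ _ fr') _ => //.
  by move=> k k1 k2; rewrite fr2 // k2.
Qed.

Lemma computable_const dv q : computable dv (fun _ _ => q).
Proof.
exists (fun=> rat_size q); split=> [|S s vs ok|rs dv' dt srs lrs].
- by auto with pbdd.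
- exact: height_rat_size.
exists (Write (Const (tcell dt)%:~R) (Const q)).
exists (fun=> 1 + (rat_size (tcell dt)%:~R + 0) + (rat_size q + 0))%N.
split; first by auto with pbdd.
move=> S s vs M ok rep; do 2!eexists; split.
- exact: exec_write_const.
- by [].
- by rewrite updateE.
- exact: frame_update_t.
Qed.

Lemma computable_var dv : computable dv.+1 (fun _ vs => (nth 0%N vs 0)%:R).
Proof.
have vb S s vs : env_ok S dv.+1 s vs -> (nth 0%N vs 0 <= S)%N.
  by case: vs => [|k vs] [] //= _ _ /andP[].
exists (fun S => S + 1)%N; split=> [|S s vs ok|rs dv' dt srs lrs].
- by auto with pbdd.
- by rewrite addn1; apply/height_le_nat/(vb _ _ _ ok).
set v := vcell (nth 0%N rs 0).
exists (Write (Const (tcell dt)%:~R) (cell v)).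
exists (fun S => 1 + (rat_size (tcell dt)%:~R + 0) + (2 * S + 2 + (rat_size v%:~R + 0)))%N.
split; first by auto 10 with pbdd.
move=> S s vs M ok rep; do 2!eexists; split.
- exact: exec_write_const.
- have [_ _ h3] := rep; rewrite /= intrKfloor h3 ?srs //.
  have := rat_size_nat (vb _ _ _ ok); lia.
- by rewrite updateE eval_cell; have [_ _ ->] := rep; rewrite ?srs.
- exact: frame_update_t.
Qed.

Lemma computable_weaken dv f : computable dv f ->
  computable dv.+1 (fun s vs => f s (behead vs)).
Proof.
have okb S s vs : env_ok S dv.+1 s vs -> env_ok S dv s (behead vs).
  move=> [h1 h2 h3]; split=> //; first by rewrite size_behead h2.
  by case: vs {h2} h3 => //= k vs /andP[].
move=> [sg [sgp sgb pf]]; exists sg; split=> [//|S s vs ok|rs dv' dt srs lrs].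
  exact/sgb/okb.
have [||p [tau [taup hp]]] := pf (behead rs) dv' dt.
- by rewrite size_behead srs.
- by case: rs lrs {srs} => //= k rs /andP[].
exists p, tau; split=> // S s vs M ok [h1 h2 h3]; apply: hp; first exact: okb.
split=> // i; rewrite size_behead srs /= => hi.
by rewrite !nth_behead h3 // srs.
Qed.

Lemma computable_if dv c f g : computable dv c -> computable dv f -> computable dv g ->
  computable dv (fun s vs => if 0 < c s vs then f s vs else g s vs).
Proof.
move=> [sc [scp scb pc]] [sf [sfp sfb pf]] [sg [sgp sgb pg]].
exists (fun S => sf S + sg S)%N; split=> [|S s vs ok|rs dv' dt srs lrs].
- by auto with pbdd.
- by case: ifP => _; [apply: height_leW (sfb _ _ _ ok)|apply: height_leW (sgb _ _ _ ok)]; lia.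
have [q [tau0 [taup0 hq]]] := pc rs dv' dt srs lrs.
have [p [tau [taup hp]]] := pf rs dv' dt srs lrs.
have [p' [tau' [taup' hp']]] := pg rs dv' dt srs lrs.
exists (Seq q (IfPos (cell (tcell dt)) p p')).
exists (fun S => 2 + tau0 S + tau S + tau' S + (2 * sc S + (rat_size (tcell dt)%:~R + 0)))%N.
split; first by auto 10 with pbdd.
move=> S s vs M ok rep.
have [t0 [M0 [e0 et0 ev0 fr0]]] := hq S s vs M ok rep.
have rep0 := env_rep_frame lrs fr0 rep.
have gc : (eval_cost M0 (cell (tcell dt)) <= 2 * sc S + (rat_size (tcell dt)%:~R + 0))%N.
  rewrite /= intrKfloor ev0; have := rat_size_height (scb _ _ _ ok); lia.
case: (ltP 0 (c s vs)) => h.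
- have [t [M' [e et ev fr]]] := hp S s vs M0 ok rep0.
  do 2!eexists; split; first apply: (ExecSeq e0 (ExecIfTrue _ _ e)).
  + by rewrite eval_cell ev0.
  + by move: gc; move: (eval_cost _ _) => x; lia.
  + by [].
  + exact: frame_trans fr0 fr.
- have [t [M' [e et ev fr]]] := hp' S s vs M0 ok rep0.
  do 2!eexists; split; first apply: (ExecSeq e0 (ExecIfFalse _ _ e)).
  + by rewrite eval_cell ev0.
  + by move: gc; move: (eval_cost _ _) => x; lia.
  + by [].
  + exact: frame_trans fr0 fr.
Qed.

Lemma computable_ext dv f g : computable dv f ->
  (forall S s vs, env_ok S dv s vs -> f s vs = g s vs) -> computable dv g.
Proof.
move=> [sg [sgp sgb pf]] fg; exists sg; split=> [//|S s vs ok|rs dv' dt srs lrs].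
  by rewrite -(fg S s vs ok); apply: sgb.
have [p [tau [taup hp]]] := pf rs dv' dt srs lrs.
exists p, tau; split=> // S s vs M ok rep.
by rewrite -(fg S s vs ok); apply: hp.
Qed.

(** Indirect addressing: once the address [A s vs] is computable, so is the value stored there,
    provided that its height is bounded separately. *)
Lemma computable_read dv (A : ctx -> seq nat -> int) g sg :
  poly_bounded sg ->
  (forall S s vs, env_ok S dv s vs -> height_le (sg S) (g s vs)) ->
  (forall s rs vs M, env_rep s rs vs M -> M (A s vs) = g s vs) ->
  computable dv (fun s vs => (A s vs)%:~R) -> computable dv g.
Proof.
move=> sgp sgb hM [sa [sap sab pa]].
exists sg; split=> // rs dv' dt srs lrs.
have [p [tau [taup hp]]] := pa rs dv' dt srs lrs.
exists (Seq p (Write (Const (tcell dt)%:~R) (Read (cell (tcell dt))))).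
exists (fun S => 1 + tau S + (1 + (rat_size (tcell dt)%:~R + 0) +
  (2 * sg S + (2 * sa S + (rat_size (tcell dt)%:~R + 0)))))%N.
split; first by auto 15 with pbdd.
move=> S s vs M ok rep.
have [t [M' [e et ev fr]]] := hp S s vs M ok rep.
have rep' := env_rep_frame lrs fr rep.
do 2!eexists; split.
- exact: ExecSeq e (exec_write_const _ _ _).
- rewrite /= !intrKfloor ev intrKfloor (hM _ _ _ _ rep').
  have := rat_size_height (sgb _ _ _ ok); have := rat_size_height (sab _ _ _ ok); lia.
- by rewrite updateE /= intrKfloor ev intrKfloor (hM _ _ _ _ rep').
- by apply: frame_trans fr _; apply: frame_update_t.
Qed.

Lemma computable_inp dv a : computable dv (fun s vs => (a s vs)%:R) ->
  computable dv (fun s vs => inp s (a s vs)).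
Proof.
apply: (@computable_read dv (fun s vs => Posz (a s vs)) _ id).
- by auto with pbdd.
- by move=> S s vs [[_ h _] _ _].
- by move=> s rs vs M [h _ _].
Qed.

Lemma computable_zval dv a : computable dv (fun s vs => (a s vs)%:R) ->
  computable dv (fun s vs => zval s (a s vs)).
Proof.
move=> ha; apply: (@computable_read dv (fun s vs => zcell (a s vs)) _ id).
- by auto with pbdd.
- by move=> S s vs [[_ _ h] _ _].
- by move=> s rs vs M [_ h _].
(* [Negz k] is [-(k + 1)], so the address with residue 2 is minus [4 * k + 3]. *)
have -> : (fun s vs => (zcell (a s vs))%:~R) =
    (fun s vs => - (4 * (a s vs)%:R + 3)) :> (ctx -> seq nat -> rat).
  apply/funext => s; apply/funext => vs.
  by rewrite /zcell NegzE -addnS mulrNz -pmulrn natrD natrM.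
apply: computable_unary unary_opp _.
apply: computable_binary binary_add _ (computable_const _ _).
exact: computable_binary binary_mul (computable_const _ _) ha.
Qed.

Fixpoint fold_up (T : Type) (op : T -> T -> T) (x : T) (f : nat -> T) (n : nat) : T :=
  if n is n'.+1 then op (fold_up op x f n') (f n') else x.

(** The loop counter lives in the new register [dv'], the accumulator in temporary [dt], and each
    term is evaluated into [dt.+1]. Each of at most [S] rounds adds at most [sg S + 1] to the height
    of the accumulator. *)
Lemma computable_fold op x c dv G : binary op -> (c < 3)%N ->
  computable dv.+1 (fun s vs => G s (behead vs) (nth 0%N vs 0)) ->
  computable dv (fun s vs => fold_up op x (G s vs) (count_of c s)).
Proof.
move=> [hop pop] c3 [sg [sgp sgb pG]].
have okS S s vs k : env_ok S dv s vs -> (k < count_of c s)%N -> env_ok S dv.+1 s (k :: vs).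
  move=> [hc hv ha] hk; split=> //=; first by rewrite hv.
  by rewrite ha andbT; have [h _ _] := hc; have [_] := h c c3; lia.
have fb S s vs k : env_ok S dv s vs -> (k <= count_of c s)%N ->
    height_le (rat_size x + k * (sg S + 1)) (fold_up op x (G s vs) k).
  move=> ok; elim: k => [|k IH] hk /=.
    by rewrite mul0n addn0; apply: height_rat_size.
  have h := sgb _ _ _ (okS _ _ _ _ ok hk).
  by apply: height_leW (hop _ _ _ _ (IH (ltnW hk)) h); rewrite mulSn; lia.
have dS S s vs : env_ok S dv s vs -> (count_of c s <= S)%N.
  by move=> [[h _ _] _ _]; have [] := h c c3.
have fbS S s vs k : env_ok S dv s vs -> (k <= count_of c s)%N ->
    height_le (rat_size x + S * (sg S + 1)) (fold_up op x (G s vs) k).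
  move=> ok hk; apply: height_leW (fb _ _ _ _ ok hk).
  by rewrite leq_add2l leq_mul2r (leq_trans hk (dS _ _ _ ok)) orbT.
exists (fun S => rat_size x + S * (sg S + 1))%N; split=> [|S s vs ok|rs dv' dt srs lrs].
- by auto 10 with pbdd.
- by apply: fbS ok _.
have [||pb [tau [taup hp]]] := pG (dv' :: rs) dv'.+1 dt.+1.
- by rewrite /= srs.
- rewrite /= ltnSn /=; apply: sub_all lrs => i /=; lia.
have [q [K hq]] := pop (tcell dt) (tcell dt.+1) ltac:(apply: tcell_neq; lia).
exists (Seq (Write (Const (tcell dt)%:~R) (Const x))
  (for_loop (vcell dv') (Posz c) (Seq pb q))).
pose body S := (1 + tau S + (K + 20 * (rat_size x + S * (sg S + 1) + sg S)))%N.
exists (fun S => 1 + (1 + (rat_size (tcell dt)%:~R + 0) + (rat_size x + 0)) +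
  (S + 1) * (body S + 40 * (S + `|vcell dv'| + c + 2)))%N.
split; first by rewrite /body; auto 20 with pbdd.
move=> S s vs M ok rep.
pose J k M1 := [/\ M1 (vcell dv') = k%:R, env_rep s rs vs M1,
  M1 (tcell dt) = fold_up op x (G s vs) k & frame dv' dt M M1].
have [|||t [M' [e et [_ _ J3 J4]]]] := @for_loop_exec (vcell dv') (Posz c) (count_of c s) (Seq pb q)
  (body S) J (update M (tcell dt) x).
- move=> k M1 [-> [h _ _] _ _]; split=> //; rewrite h.
  by have [[hd _ _] _ _] := ok; have [] := hd c c3.
- move=> k M1 hk [J1 J2 J3 J4].
  have rep1 : env_rep s (dv' :: rs) (k :: vs) M1.
    have [r1 r2 r3] := J2; split=> //; case=> [//|i] /=; rewrite ltnS => hi.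
    exact: r3.
  have ok1 := okS _ _ _ _ ok hk.
  have [t [M2 [e et ev fr]]] := hp S s (k :: vs) M1 ok1 rep1.
  have ev2 : M2 (tcell dt) = fold_up op x (G s vs) k by rewrite (frame_t fr).
  have h1 : height_le (rat_size x + S * (sg S + 1) + sg S) (M2 (tcell dt)).
    by rewrite ev2; apply: height_leW (fbS _ _ _ _ ok (ltnW hk)); lia.
  have h2 : height_le (rat_size x + S * (sg S + 1) + sg S) (M2 (tcell dt.+1)).
    by rewrite ev; apply: height_leW (sgb _ _ _ ok1); lia.
  have [t2 [M3 [e2 ev3 et2 fr2]]] := hq M2 _ h1 h2.
  have fr3 : frame dv'.+1 dt M1 M3.
    apply: frame_trans (frameW _ _ fr) _ => //.
    by move=> l l1 l2; rewrite fr2 // l2.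
  have fr4 : frame dv' dt M1 (update M3 (vcell dv') k.+1%:R).
    have fru := @frame_update_v dv' dt M3 dv' k.+1%:R (leqnn _).
    have frw := frameW (leqnSn dv') (leqnn dt) fr3.
    exact: frame_trans frw fru.
  do 2!eexists; split; first exact: ExecSeq e e2.
  + by rewrite /body; lia.
  + by rewrite (frame_v fr3).
  + split.
    * by rewrite updateE.
    * exact: env_rep_frame lrs fr4 J2.
    * by rewrite updateN ?tvcell // ev3 ev2 ev.
    * exact: frame_trans J4 fr4.
- have fr0 : frame dv' dt M (update (update M (tcell dt) x) (vcell dv') 0).
    apply: (@frame_trans _ _ _ (update M (tcell dt) x)).
      exact: frame_update_t.
    exact: frame_update_v.
  split.
  + by rewrite updateE.
  + exact: env_rep_frame lrs fr0 rep.
  + by rewrite updateN ?tvcell // updateE.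
  + exact: fr0.
have ew := exec_write_const M (tcell dt) (Const x).
do 2!eexists; split; first exact: ExecSeq ew e.
- apply: leq_add; first by [].
  apply: leq_trans et _; have := dS _ _ _ ok => hd.
  by apply: leq_mul; [lia|rewrite /=; lia].
- exact: J3.
- exact: J4.
Qed.

Definition bsum (F : numDomainType) (n : nat) (f : nat -> F) : F := fold_up +%R 0 f n.
Definition bprod (F : numDomainType) (n : nat) (f : nat -> F) : F := fold_up *%R 1 f n.
Definition bmax (F : numDomainType) (n : nat) (f : nat -> F) : F := fold_up (@max2 F) 0 f n.

Lemma bsumE (F : numDomainType) n (f : nat -> F) : bsum n f = \sum_(k < n) f k.
Proof. by elim: n => [|n IH]; rewrite ?big_ord0 // big_ord_recr -IH. Qed.

Lemma bprodE (F : numDomainType) n (f : nat -> F) : bprod n f = \prod_(k < n) f k.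
Proof. by elim: n => [|n IH]; rewrite ?big_ord0 // big_ord_recr -IH. Qed.

Lemma computable_sum c dv G : (c < 3)%N ->
  computable dv.+1 (fun s vs => G s (behead vs) (nth 0%N vs 0)) ->
  computable dv (fun s vs => bsum (count_of c s) (G s vs)).
Proof. exact/computable_fold/binary_add. Qed.

Lemma computable_prod c dv G : (c < 3)%N ->
  computable dv.+1 (fun s vs => G s (behead vs) (nth 0%N vs 0)) ->
  computable dv (fun s vs => bprod (count_of c s) (G s vs)).
Proof. exact/computable_fold/binary_mul. Qed.

Lemma computable_max c dv G : (c < 3)%N ->
  computable dv.+1 (fun s vs => G s (behead vs) (nth 0%N vs 0)) ->
  computable dv (fun s vs => bmax (count_of c s) (G s vs)).
Proof. exact/computable_fold/binary_max. Qed.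

Lemma computable_add dv f g : computable dv f -> computable dv g ->
  computable dv (fun s vs => f s vs + g s vs).
Proof. exact: computable_binary binary_add. Qed.

Lemma computable_mul dv f g : computable dv f -> computable dv g ->
  computable dv (fun s vs => f s vs * g s vs).
Proof. exact: computable_binary binary_mul. Qed.

Lemma computable_opp dv f : computable dv f -> computable dv (fun s vs => - f s vs).
Proof. exact: computable_unary unary_opp. Qed.

Lemma computable_inv dv f : computable dv f -> computable dv (fun s vs => (f s vs)^-1).
Proof. exact: computable_unary unary_inv. Qed.

Lemma computable_floor dv f : computable dv f ->
  computable dv (fun s vs => (Num.floor (f s vs))%:~R).
Proof. exact: computable_unary unary_floor. Qed.

Lemma computable_count dv c : (c < 3)%N -> computable dv (fun s _ => (count_of c s)%:R).
Proof.
move=> c3; apply: (@computable_ext _ (fun s vs => inp s c)).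
  exact/computable_inp/computable_const.
by move=> S s vs [[h _ _] _ _]; have [] := h c c3.
Qed.

(** * Programs that fill an array *)

Ltac neq_cell := by apply/eqP => -[]; lia.

(** The address [Negz (4 * k + r)] for [k] in cell [v]; as [Negz] is shifted by one, the summand is
    [r.+1]. *)
Definition neg_addr (v : int) (r : nat) : expr :=
  Opp (Add (Mul (Const 4) (cell v)) (Const r.+1%:R)).

Lemma eval_cost_cell M a :
  eval_cost M (cell a) = (rat_size (M a) + (rat_size (a%:~R) + 0))%N.
Proof. by rewrite /= intrKfloor. Qed.

Lemma eval_neg_addr M v r k : M v = k%:R ->
  eval M (neg_addr v r) = (Negz (4 * k + r))%:~R.
Proof.
by move=> hv; rewrite /= intrKfloor hv NegzE -addnS mulrNz -pmulrn natrD natrM.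
Qed.

Lemma eval_cost_neg_addr M v r k : M v = k%:R ->
  (eval_cost M (neg_addr v r) <= 14 * (4 * k + r + `|v| + 6))%N.
Proof.
move=> hv; rewrite /= intrKfloor hv rat_sizeN -natrM -natrD.
have h1 : (4 * k + r.+1 <= 4 * k + r + `|v| + 5)%N by lia.
have h2 : (4 * k <= 4 * k + r + `|v| + 5)%N by lia.
have h3 : (4 <= 4 * k + r + `|v| + 5)%N by lia.
have h4 : (k <= 4 * k + r + `|v| + 5)%N by lia.
have h5 : (`|v| <= 4 * k + r + `|v| + 5)%N by lia.
have h6 : (r.+1 <= 4 * k + r + `|v| + 5)%N by lia.
have -> : (4 * k + r + `|v| + 6 = (4 * k + r + `|v| + 5).+1)%N by lia.
move: h1 h2 h3 h4 h5 h6; set K := (4 * k + r + `|v| + 5)%N; clearbody K.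
move=> *; bound_sizes K; lia.
Qed.

Definition set_z (s : ctx) (j : nat) (q : rat) : ctx :=
  Ctx (inp s) (fun k => if k == j then q else zval s k).

(** The effect of the first pass: entry [k'] is computed from the input and the entries already
    written. *)
Fixpoint run_z (E : ctx -> nat -> rat) (s : ctx) (k : nat) : ctx :=
  if k is k'.+1 then set_z (run_z E s k') k' (E (run_z E s k') k') else s.

Lemma inp_run_z E s k : inp (run_z E s k) = inp s.
Proof. by elim: k. Qed.

(** One loop fills the vector [z] with [E1], a second evaluates [E2] at the final [z] into a buffer,
    and a third copies the buffer over the input, which [E2] still had to read. The values of [E1]
    being 0 or 1 stops heights from compounding along the first loop. *)
Lemma run_program (E1 E2 : ctx -> nat -> rat) :
  computable 1 (fun s vs => E1 s (nth 0%N vs 0)) ->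
  computable 1 (fun s vs => E2 s (nth 0%N vs 0)) ->
  (forall s j, E1 s j = 0 \/ E1 s j = 1) ->
  exists p tau, poly_bounded tau /\
  forall S s M, ctx_le S s -> env_rep s [::] [::] M ->
  exists t M', [/\ exec p M t M', (t <= tau S)%N &
    forall j, (j < count_of 1 s)%N ->
      M' j%:Z = E2 (run_z E1 s (count_of 1 s)) j].
Proof.
move=> [s1 [s1p s1b c1]] [s2 [s2p s2b c2]] E01.
have [//|//|p1 [t1 [t1p h1]]] := c1 [:: 0%N] 1%N 0%N.
have [//|//|p2 [t2 [t2p h2]]] := c2 [:: 0%N] 1%N 0%N.
set v := vcell 0; set y := tcell 0.
pose b1 := Seq p1 (Write (neg_addr v 2) (cell y)).
pose b2 := Seq p2 (Write (neg_addr v 3) (cell y)).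
pose b3 := Write (cell v) (Read (neg_addr v 3)).
(* The copy overwrites cell 1, which holds the number of variables, so this loop bound is first
   saved in the temporary [y]. *)
pose p := Seq (for_loop v 1 b1) (Seq (for_loop v 1 b2)
  (Seq (Write (Const y%:~R) (cell 1)) (for_loop v y b3))).
pose B1 S := (1 + t1 S + (1 + 14 * (4 * S + 20) + (2 * s1 S + 10)))%N.
pose B2 S := (1 + t2 S + (1 + 14 * (4 * S + 20) + (2 * s2 S + 10)))%N.
pose B3 S := (1 + (2 * S + 20) + (2 * s2 S + 14 * (4 * S + 20)))%N.
pose L (f : nat -> nat) S := ((S + 1) * (f S + 40 * (S + 20)))%N.
exists p, (fun S => 4 + L B1 S + L B2 S + (20 + 2 * S) + L B3 S)%N; split.
  by rewrite /L /B1 /B2 /B3; auto 30 with pbdd.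
move=> S s M cok rep.
set n := count_of 1 s.
have nS : (n <= S)%N by have [h _ _] := cok; have [] := h 1%N isT.
have sn : inp s 1%N = n%:R by have [h _ _] := cok; have [] := h 1%N isT.
have S0 : (0 < S)%N by have [_ h _] := cok; apply: height_le_gt0 (h 0%N).
have cokr k : ctx_le S (run_z E1 s k).
  elim: k => [//|k [g1 g2 g3]]; split=> // k' /=; case: eqP => // _.
  have [->|->] := E01 (run_z E1 s k) k; apply: (@height_leW 1) => //.
have okr k j : (j < n)%N -> env_ok S 1 (run_z E1 s k) [:: j].
  by move=> jn; split=> //=; rewrite andbT (leq_trans (ltnW jn)).
have sy : (rat_size y%:~R <= 8)%N by [].
have sv : (rat_size v%:~R <= 8)%N by [].
have env1 s' k M1 : env_rep s' [::] [::] M1 -> M1 v = k%:R ->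
    env_rep s' [:: 0%N] [:: k] M1.
  by move=> [g1 g2 _] hv; split=> // -[|//] _.
have forb f N M0 q : (N <= S)%N -> (`|q| <= 10)%N ->
    (M0 <= N.+1 * (f S + 40 * (N + `|v| + `|q| + 2)))%N -> (M0 <= L f S)%N.
  move=> NS hq /leq_trans; apply; apply: leq_mul; first by lia.
  by rewrite leq_add2l leq_mul2l /=; rewrite /v /vcell /=; lia.
pose J1 k M1 := M1 v = k%:R /\ env_rep (run_z E1 s k) [::] [::] M1.
have [|||ta [Ma [ea tab [_ repa]]]] := @for_loop_exec v 1 n b1 (B1 S) J1 M.
- by move=> k M1 [-> [g _ _]]; split=> //; rewrite (g 1%N) inp_run_z.
- move=> k M1 kn [J1v J1r].
  have [t [M2 [e et ev fr]]] := h1 S (run_z E1 s k) [:: k] M1 (okr _ _ kn) (env1 _ _ _ J1r J1v).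
  have v2 : M2 v = k%:R by rewrite (frame_v fr).
  have ew := ExecWrite (neg_addr v 2) (cell y) M2.
  rewrite (eval_neg_addr _ v2) intrKfloor eval_cell ev in ew.
  do 2!eexists; split; first exact: ExecSeq e ew.
  + rewrite /B1; have := eval_cost_neg_addr 2 v2; rewrite eval_cost_cell ev.
    have := rat_size_height (s1b _ _ _ (okr k _ kn)); move: (eval_cost _ _) => z.
    by rewrite /v /vcell /=; lia.
  + by rewrite updateN //; neq_cell.
  + split; first by rewrite updateE.
    have [g1 g2 _] := J1r.
    split=> [i|i|//].
    * by rewrite !updateN //; rewrite (frame_pos _ fr) g1.
    * rewrite updateN; last by apply/eqP => -[]; lia.
      rewrite /=; case: eqP => [->|/eqP ik]; first by rewrite updateE.
      rewrite updateN; last by apply/eqP => -[]; move/eqP: ik; lia.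
      by rewrite (frame_z _ fr) g2.
- split; first by rewrite updateE.
  have [g1 g2 _] := rep; split=> [i|i|//]; rewrite updateN //.
  by apply/eqP => -[]; lia.
set r := run_z E1 s n in repa *.
pose J2 k M1 := [/\ M1 v = k%:R, env_rep r [::] [::] M1 &
  forall j, (j < k)%N -> M1 (ycell j) = E2 r j].
have [|||tb [Mb [eb tbb [_ repb yb]]]] := @for_loop_exec v 1 n b2 (B2 S) J2 Ma.
- by move=> k M1 [-> [g _ _] _]; split=> //; rewrite (g 1%N) inp_run_z.
- move=> k M1 kn [J1v J1r J1y].
  have [t [M2 [e et ev fr]]] := h2 S r [:: k] M1 (okr _ _ kn) (env1 _ _ _ J1r J1v).
  have v2 : M2 v = k%:R by rewrite (frame_v fr).
  have ew := ExecWrite (neg_addr v 3) (cell y) M2.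
  rewrite (eval_neg_addr _ v2) intrKfloor eval_cell ev in ew.
  do 2!eexists; split; first exact: ExecSeq e ew.
  + rewrite /B2; have := eval_cost_neg_addr 3 v2; rewrite eval_cost_cell ev.
    have := rat_size_height (s2b _ _ _ (okr n _ kn)); rewrite -/r; move: (eval_cost _ _) => z.
    by rewrite /v /vcell /=; lia.
  + by rewrite updateN //; neq_cell.
  + have [g1 g2 _] := J1r; split; first by rewrite updateE.
    * split=> [i|i|//].
      - rewrite !updateN //; rewrite (frame_pos _ fr) g1 //.
      - rewrite !updateN; [|by apply/eqP => -[]; lia..].
        by rewrite (frame_z _ fr) g2.
    * move=> j; rewrite ltnS leq_eqVlt => /orP[/eqP ->|jk].
        by rewrite updateN; [rewrite updateE|apply/eqP => -[]; lia].
      rewrite !updateN; [|by apply/eqP => -[]; lia..].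
      by rewrite (frame_y _ fr) J1y.
- split; first by rewrite updateE.
    have [g1 g2 _] := repa; split=> [i|i|//]; rewrite updateN //.
    by apply/eqP => -[]; lia.
  by [].
have b1n : Mb 1 = n%:R by have [g _ _] := repb; rewrite (g 1%N) inp_run_z.
have ec := exec_write_const Mb y (cell 1).
rewrite eval_cell b1n in ec.
pose J3 k M1 := [/\ M1 v = k%:R, M1 y = n%:R, forall j, (j < n)%N -> M1 (ycell j) = E2 r j &
  forall j, (j < k)%N -> M1 j%:Z = E2 r j].
have [|||tc [Mc [ec' tcb [_ _ _ yc]]]] := @for_loop_exec v y n b3 (B3 S) J3 (update Mb y n%:R).
- by move=> k M1 [-> -> _ _].
- move=> k M1 kn [J1v J1y Jy Jx].
  have ew := ExecWrite (cell v) (Read (neg_addr v 3)) M1.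
  have er : eval M1 (Read (neg_addr v 3)) = E2 r k.
    rewrite (_ : eval M1 (Read _) = M1 (Num.floor (eval M1 (neg_addr v 3)))) //.
    by rewrite (eval_neg_addr _ J1v) intrKfloor Jy.
  rewrite eval_cell J1v er -[k%:R]/((Posz k)%:~R) intrKfloor in ew.
  do 2!eexists; split; first exact: ew.
  + rewrite /B3; have := eval_cost_neg_addr 3 J1v.
    rewrite (_ : eval_cost M1 (Read _) =
      rat_size (eval M1 (Read (neg_addr v 3))) + eval_cost M1 (neg_addr v 3))%N // er.
    have := rat_size_height (s2b _ _ _ (okr n _ kn)); rewrite -/r [nth _ _ _]/=; move: (eval_cost _ (neg_addr _ _)) => z.
    rewrite eval_cost_cell J1v; have := rat_size_nat (ltnW kn).
    rewrite (_ : `|v|%N = 1%N) //; move: sv.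
    move: (rat_size v%:~R) (rat_size k%:R) (rat_size (E2 r k)) => x1 x2 x3.
    move: {kn} (kn : (k < n)%N) nS; clear; move: n => n'; lia.
  + by rewrite updateN //; neq_cell.
  + split; first by rewrite updateE.
    * by rewrite !updateN //; neq_cell.
    * by move=> j jn; rewrite !updateN; [apply: Jy|by []|by apply/eqP => -[]; lia].
    * move=> j; rewrite ltnS leq_eqVlt => /orP[/eqP ->|jk].
        by rewrite updateN // updateE.
      rewrite !updateN //; first exact: Jx.
      by apply/eqP => -[]; lia.
- split; first by rewrite updateE.
  + by rewrite updateN // updateE.
  + by move=> j jn; rewrite !updateN ?yb //; apply/eqP => -[]; lia.
  + by [].
do 2!eexists; split; first exact: ExecSeq ea (ExecSeq eb (ExecSeq ec ec')).
- have := forb _ _ _ _ nS _ tab; have := forb _ _ _ _ nS _ tbb; have := forb _ _ _ _ nS _ tcb.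
  move=> /(_ isT) xc /(_ isT) xb /(_ isT) xa.
  rewrite eval_cost_cell b1n; have := rat_size_nat nS.
  have : (rat_size 1%:~R <= 2)%N by [].
  move: xa xb xc; move: (L _ _) (L _ _) (L _ _) => xa xb xc; lia.
- exact: yc.
Qed.

(** * Two ingredients: an exponential bound and a knapsack rounding *)

Section ExpBound.
Variable R : realType.

(** By [1 + t <= expR t] it suffices that [(1 - x) * (1 + x + 2 * x ^+ 2) = 1 + x ^+ 2 * (1 - 2 *
    x)] is at least 1. *)
Lemma expR_le_subr1 (x : R) : 0 <= x <= 2^-1 -> expR (- (x + 2 * x ^+ 2)) <= 1 - x.
Proof.
move=> /andP[x0 x2].
have h : 0 < 1 + (x + 2 * x ^+ 2) by nra.
rewrite expRN; apply: le_trans (_ : (1 + (x + 2 * x ^+ 2))^-1 <= _).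
  by rewrite lef_pV2 ?posrE ?expR_gt0 // expR_ge1Dx.
rewrite -[leLHS]mul1r ler_pdivrMr //; nra.
Qed.

(** [N.+1] is the telescoping product of the factors [1 + k.+1^-1], and each factor is at most the
    exponential of [k.+1^-1]. *)
Lemma natr_le_expR_harmonic N : N.+1%:R <= expR (\sum_(k < N) k.+1%:R^-1) :> R.
Proof.
elim: N => [|N IH]; first by rewrite big_ord0 expR0.
rewrite big_ord_recr /= expRD.
apply: le_trans (_ : N.+1%:R * (1 + N.+1%:R^-1) <= _).
  by rewrite mulrDr mulr1 divff // natr1.
by apply: ler_pM => //; rewrite ?addr_ge0 ?invr_ge0 ?expR_ge1Dx.
Qed.

(** The same telescoping product in the other direction, with [ln (1 + y) >= y / (1 + y) >= y / 2]
    for [0 < y <= 1]. *)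
Lemma harmonic_le_ln N : \sum_(k < N) k.+1%:R^-1 <= 2 * ln (1 + N%:R) :> R.
Proof.
elim: N => [|N IH]; first by rewrite big_ord0 addr0 ln1 mulr0.
rewrite big_ord_recr /=.
have hN : 0 < N.+1%:R :> R by [].
have e : 1 + N.+1%:R = (1 + N%:R) * (1 + N.+1%:R^-1) :> R.
  by rewrite [1 + N%:R]addrC natr1 mulrDr mulr1 divff // addrC.
rewrite e lnM ?posrE; [|by rewrite addrC natr1|by rewrite addr_gt0 // invr_gt0].
rewrite mulrDr lerD //.
set y := N.+1%:R^-1.
have y0 : 0 < y by rewrite invr_gt0.
have y1 : y <= 1 by rewrite invf_le1 // ler1n.
have : - ln (1 + y) <= (1 + y)^-1 - 1.
  rewrite -lnV ?posrE; last by lra.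
  have := @le_ln1Dx R ((1 + y)^-1 - 1); rewrite [1 + (_ - 1)]addrC subrK; apply.
  by rewrite ltrBrDr addNr invr_gt0; lra.
have -> : (1 + y)^-1 - 1 = - (y / (1 + y)) by field; lra.
rewrite lerN2 => h.
have : y / 2 <= y / (1 + y) by rewrite ler_pM2l // lef_pV2 ?posrE; lra.
lra.
Qed.

End ExpBound.

(** The Chernoff bound in the form used by the estimator: an outcome [z] that falls short of the
    mean by the harmonic sum has a product at least [1 + N] times the initial one. The statement is
    free of exponentials, so it makes sense over [rat], where the machine computes. *)
Definition product_bound (F : numFieldType) : Prop :=
  forall (n N : nat) (u p z : nat -> F),
  (forall j, (j < n)%N -> [/\ 0 <= u j <= 2^-1, 0 <= p j <= 1 & 0 <= z j <= 1]) ->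
  (forall j, (j < n)%N -> z j = 0 \/ z j = 1) ->
  \sum_(k < N) k.+1%:R^-1 + \sum_(j < n) (u j + 2 * u j ^+ 2) * z j
    <= \sum_(j < n) u j * p j ->
  (1 + N%:R) * \prod_(j < n) (1 - u j * p j) <= \prod_(j < n) (1 - u j * z j).

(** The left side is at most [expR] of the harmonic sum minus the mean. On the right, a factor with
    [z j = 1] is at least [expR (- (u j + 2 * u j ^+ 2))], and one with [z j = 0] equals 1. *)
Lemma product_bound_real (R : realType) : product_bound R.
Proof.
move=> n N u p z ub z01 H.
apply: le_trans (_ : expR (\sum_(k < N) k.+1%:R^-1) * expR (- \sum_(j < n) u j * p j) <= _).
  apply: ler_pM.
  - by rewrite addr_ge0.
  - apply: prodr_ge0 => j _; have [/andP[u0 u1] /andP[p0 p1] _] := ub j (ltn_ord j).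
    by rewrite subr_ge0; nra.
  - by rewrite addrC natr1; apply: natr_le_expR_harmonic.
  - rewrite -sumrN expR_sum; apply: ler_prod => j _.
    have [/andP[u0 u1] /andP[p0 p1] _] := ub j (ltn_ord j).
    by rewrite subr_ge0 expR_ge1Dx andbT; nra.
rewrite -expRD; apply: le_trans (_ : expR (- \sum_(j < n) (u j + 2 * u j ^+ 2) * z j) <= _).
  by rewrite ler_expR; lra.
rewrite -sumrN expR_sum; apply: ler_prod => j _; rewrite expR_ge0 /=.
have [ub0 _ _] := ub j (ltn_ord j).
have [zj|zj] := z01 j (ltn_ord j); rewrite zj.
  by rewrite !mulr0 subr0 oppr0 expR0.
by rewrite !mulr1; apply: expR_le_subr1.
Qed.

(** All terms are rational, so the inequality is pulled back along the order embedding [ratr] from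
    the reals, where the exponential is available. *)
Lemma product_bound_rat (R : realType) : product_bound rat.
Proof.
move=> n N u p z ub z01 H; rewrite -(ler_rat R).
have e (w : nat -> rat) : ratr (\prod_(j < n) (1 - u j * w j)) =
    \prod_(j < n) (1 - ratr (u j) * ratr (w j)) :> R.
  by rewrite rmorph_prod; apply: eq_bigr => j _; rewrite rmorphB rmorph1 rmorphM.
rewrite rmorphM rmorphD rmorph1 rmorph_nat /= !e.
apply: (@product_bound_real R n N (fun j => ratr (u j)) (fun j => ratr (p j))
  (fun j => ratr (z j))).
- move=> j /ub[/andP[u0 u1] p01 z01']; split.
  + rewrite ler0q u0 /=; apply: le_trans (_ : ratr 2^-1 <= _); first by rewrite ler_rat.
    by rewrite fmorphV rmorph_nat.
  + by rewrite ler0q -(rmorph1 (@ratr R)) ler_rat.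
  + by rewrite ler0q -(rmorph1 (@ratr R)) ler_rat.
- by move=> j /z01[->|->]; [left|right]; rewrite ?rmorph0 ?rmorph1.
- move: H; rewrite -(ler_rat R) rmorphD !rmorph_sum /=; congr (_ + _ <= _).
  + by apply: eq_bigr => k _; rewrite fmorphV rmorph_nat.
  + by apply: eq_bigr => j _; rewrite rmorphM rmorphD rmorphM rmorphXn rmorph_nat.
  + by apply: eq_bigr => j _; rewrite rmorphM.
Qed.

(** * Greedy rounding of a fractional covering knapsack *)

Section Knapsack.
Variables (F : realFieldType) (n : nat) (b c v : nat -> F) (r K : F).

(** Increasing cost density, with ties broken by index so that distinct items are always comparable.
    An item of weight zero gets density 0 by the convention for division, but adds nothing to any
    prefix. *)
Definition before (k j : nat) : bool :=
  (c k / b k < c j / b j) || ((c k / b k == c j / b j) && (k < j)%N).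

Lemma before_trans k j l : before k j -> before j l -> before k l.
Proof.
rewrite /before => /orP[h1|/andP[/eqP h1 i1]] /orP[h2|/andP[/eqP h2 i2]].
- by rewrite (lt_trans h1 h2).
- by rewrite -h2 h1.
- by rewrite h1 h2.
- by rewrite h1 h2 eqxx (ltn_trans i1 i2) orbT.
Qed.

Lemma before_total k j : [|| before k j, k == j | before j k].
Proof.
rewrite /before; case: (ltgtP (c k / b k) (c j / b j)) => //= _; rewrite ?orbT //.
by case: (ltngtP k j); rewrite ?orbT.
Qed.

Definition prefix (j : nat) : F := \sum_(k < n) (if before k j then b k else 0).

(** The greedy choice without sorting: an item is taken exactly when the items before it do not yet
    reach the demand [r]. Each item thus decides for itself by one sum, which a counted loop can
    evaluate. *)
Definition picked (j : nat) : bool := (0 < b j) && (prefix j < r).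

Hypotheses (b0 : forall j, (j < n)%N -> 0 <= b j <= K)
  (c0 : forall j, (j < n)%N -> 0 <= c j)
  (v01 : forall j, (j < n)%N -> 0 < b j -> 0 <= v j <= 1)
  (r0 : 0 < r) (K0 : 0 <= K) (rv : r + K <= \sum_(j < n | 0 < b j) b j * v j).

Lemma prefix_lt k j : (k < n)%N -> 0 < b k -> before k j -> prefix k + b k <= prefix j.
Proof.
move=> kn bk kj; rewrite /prefix (bigD1 (Ordinal kn)) //= [leRHS](bigD1 (Ordinal kn)) //=.
rewrite kj; have -> : before k k = false by rewrite /before ltxx ltnn andbF.
rewrite /= add0r [leLHS]addrC lerD2l; apply: ler_sum => i _.
case: ifP => [ik|_]; first by rewrite (before_trans ik kj).
by case: ifP => // _; have /andP[] := b0 (ltn_ord i).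
Qed.

(** Items weigh at most [K], so the greedy set weighs less than [r + K], which is at most the weight
    of the fractional [v]. Since the greedy set uses the cheapest densities, [v] cannot cost
    less. *)
Lemma knapsack_greedy :
  r <= \sum_(j < n | picked j) b j /\
  \sum_(j < n | picked j) c j <= \sum_(j < n | 0 < b j) c j * v j.
Proof.
have pickedP (j : 'I_n) : picked j -> 0 < b j by case/andP.
(* The picks overshoot r by at most one item. *)
have ub : \sum_(j < n | picked j) b j < r + K.
  have [i pi|none] := pickP (fun j : 'I_n => picked j); last by rewrite (eq_bigl _ _ none) big_pred0_eq ltr_wpDr.
  case: (@arg_maxP _ _ _ i (fun j : 'I_n => picked j) (fun j => prefix j) pi) => l pl lmax.
  rewrite (bigD1 l) //=.
  have /andP[bl prl] := pl.
  apply: le_lt_trans (_ : b l + prefix l < _); last first.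
    by rewrite addrC; apply: ltr_leD => //; have /andP[] := b0 (ltn_ord l).
  rewrite lerD2l /prefix big_mkcond /=; apply: ler_sum => k _.
  case: ifP => [/andP[pk kl]|_]; last by case: ifP => // _; have /andP[] := b0 (ltn_ord k).
  have /or3P[->//|/eqP e|lk] := before_total k l; first by move: kl; rewrite -(inj_eq val_inj) /= e eqxx.
  have := prefix_lt (ltn_ord l) bl lk; have := lmax k pk; rewrite /=; lra.
(* Were every item of positive weight picked, the picks would weigh at least [r + K], against
   [ub]. *)
have ex : exists i : 'I_n, (0 < b i) && (r <= prefix i).
  apply/existsP; apply: contraT; rewrite negb_exists => /forallP none.
  have : \sum_(j < n | 0 < b j) b j * v j <= \sum_(j < n | picked j) b j.
    rewrite [leRHS](eq_bigl (fun j : 'I_n => 0 < b j)).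
      apply: ler_sum => j bj; have /andP[v0 v1] := v01 (ltn_ord j) bj.
      by rewrite -[leRHS]mulr1 ler_wpM2l // ltW.
    move=> j; rewrite /picked; have := none j; case: (0 < b j) => //=.
    by rewrite -ltNge => ->.
  by move: rv ub; lra.
have {ex} [i pi] := ex.
case: (@arg_minP _ _ _ i (fun j : 'I_n => (0 < b j) && (r <= prefix j)) (fun j => prefix j) pi).
move=> l /andP[bl rl] lmin.
have before_l (k : 'I_n) : 0 < b k -> picked k -> before k l.
  move=> bk /andP[_ pk]; have /or3P[//|/eqP e|lk] := before_total k l.
    by move: pk; rewrite e; lra.
  by have := prefix_lt (ltn_ord l) bl lk; lra.
have after_l (k : 'I_n) : 0 < b k -> ~~ picked k -> c l / b l <= c k / b k.
  move=> bk; rewrite /picked bk /= -leNgt => pk.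
  have : ~~ before k l.
    apply/negP => kl; have := prefix_lt (ltn_ord k) bk kl.
    have := lmin k; rewrite /= bk pk => /(_ isT); lra.
  by rewrite /before negb_or -leNgt => /andP[].
split.
  apply: le_trans rl _; rewrite /prefix [leRHS]big_mkcond /=.
  apply: ler_sum => k _; case: ifP => [kl|_].
    case: ifPn => // npk; rewrite leNgt; apply/negP => bk.
    have := prefix_lt (ltn_ord k) bk kl.
    move: npk; rewrite /picked bk /= -leNgt => pk.
    by have := lmin k; rewrite /= bk pk => /(_ isT); lra.
  by case: ifP => // _; have /andP[] := b0 (ltn_ord k).
(* Exchange argument at the density rho of the first item left out. *)
pose rho := c l / b l.
have rho0 : 0 <= rho by rewrite divr_ge0 ?c0 // ltW.
have split_pos (f : 'I_n -> F) : \sum_(j < n | 0 < b j) f j =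
    \sum_(j < n | picked j) f j + \sum_(j < n | (0 < b j) && ~~ picked j) f j.
  rewrite (bigID (fun j : 'I_n => picked j)) /=; congr (_ + _).
  by apply: eq_bigl => j; rewrite /picked; case: (0 < b j).
have h1 : \sum_(j < n | picked j) c j * (1 - v j) <=
    rho * \sum_(j < n | picked j) b j * (1 - v j).
  rewrite mulr_sumr; apply: ler_sum => j pj; have bj := pickedP _ pj.
  have /andP[v0 v1] := v01 (ltn_ord j) bj.
  rewrite mulrA ler_wpM2r ?subr_ge0 //.
  rewrite -ler_pdivrMr //.
  by have := before_l j bj pj; rewrite /before => /orP[/ltW//|/andP[/eqP->]].
have h2 : rho * \sum_(j < n | (0 < b j) && ~~ picked j) b j * v j <=
    \sum_(j < n | (0 < b j) && ~~ picked j) c j * v j.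
  rewrite mulr_sumr; apply: ler_sum => j /andP[bj npj].
  have /andP[v0 v1] := v01 (ltn_ord j) bj.
  by rewrite mulrA ler_wpM2r // -ler_pdivlMr // after_l.
have h3 : \sum_(j < n | picked j) b j * (1 - v j) <=
    \sum_(j < n | (0 < b j) && ~~ picked j) b j * v j.
  have -> : \sum_(j < n | picked j) b j * (1 - v j) =
      \sum_(j < n | picked j) b j - \sum_(j < n | picked j) b j * v j.
    by rewrite -sumrB; apply: eq_bigr => j _; rewrite mulrBr mulr1.
  by move: rv; rewrite split_pos; lra.
have h4 : \sum_(j < n | picked j) c j * (1 - v j) =
    \sum_(j < n | picked j) c j - \sum_(j < n | picked j) c j * v j.
  by rewrite -sumrB; apply: eq_bigr => j _; rewrite mulrBr mulr1.
rewrite split_pos; have := ler_wpM2l rho0 h3; lra.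
Qed.

End Knapsack.

(** * The rounding algorithm *)

Section Max.
Variable F : realFieldType.
Implicit Types (f : nat -> F) (n : nat).

Lemma max2E (x y : F) : max2 x y = Num.max x y.
Proof. by rewrite /max2 subr_gt0 maxElt; case: ltgtP. Qed.

Lemma bmax_ge0 n f : 0 <= bmax n f.
Proof.
by elim: n => [|n IH]; rewrite /bmax /= ?lexx // -/(bmax n f) max2E le_max IH.
Qed.

Lemma le_bmax n f k : (k < n)%N -> f k <= bmax n f.
Proof.
elim: n => // n IH; rewrite ltnS leq_eqVlt /bmax /= -/(bmax n f) max2E le_max.
by case/orP => [/eqP->|/IH->//]; rewrite lexx orbT.
Qed.

Lemma bmax_attained n f : bmax n f = 0 \/ exists2 k, (k < n)%N & bmax n f = f k.
Proof.
elim: n => [|n IH]; first by left.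
rewrite /bmax /= -/(bmax n f) max2E; case: (leP (bmax n f) (f n)) => _.
  by right; exists n.
case: IH => [->|[k kn ->]]; [by left|right; exists k => //; exact: ltnW].
Qed.

End Max.

(** * The quantities computed by the algorithm *)

Section Algorithm.
Variables (F : archiRealFieldType) (m n : nat) (eps : F).
Variables (A0 : nat -> nat -> F) (c x : nat -> F).

Definition fl (j : nat) : F := (Num.floor ((1 + eps) * x j))%:~R.
Definition fr (j : nat) : F := (1 + eps) * x j - fl j.
(** Columns where [(1 + eps) * x j] is an integer are dropped, as they need no rounding. On the
    others [x j] is positive, so a positive entry of [A] forces [Ax i] to be positive. *)
Definition A (i j : nat) : F := if 0 < fr j then A0 i j else 0.
Definition Ax (i : nat) : F := bsum n (fun j => A0 i j * x j).
(** The reciprocal width is taken relative to [A xbar] in place of [a]; as [A xbar >= a], this can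
    only improve the bound. *)
Definition inv_width : F := bmax m (fun i => bmax n (fun j => A i j / Ax i)).
Definition degree : F :=
  bmax n (fun j => bsum m (fun i => if 0 < A i j then 1 else 0)).
(** The harmonic number of [degree]. Loops run up to an input dimension, so the sum goes to [m] and
    is cut off at [degree]. *)
Definition degree_harmonic : F :=
  bsum m (fun k => if 0 < degree - k%:R then (k%:R + 1)^-1 else 0).
(* 1 / W is inv_width, and its junk value 0 when A = 0 is the right one. *)
Definition lam : F := 1 + 8 * (degree_harmonic * inv_width) / (eps * eps).
Definition prob (j : nat) : F := if 0 < 1 - lam * fr j then lam * fr j else 1.
(** The coefficient [u] of the estimator, scaled to lie between 0 and [eps / 8]. If [Ax i] or
    [inv_width] is zero, the default inverse makes it 0. *)
Definition tilt (i j : nat) : F := eps / 8 * (A i j / Ax i) / inv_width.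
Definition penalty (i : nat) : F :=
  lam * bsum n (fun j => if 0 < A i j then c j * fr j else 0).
(** Normalised so that at [prob] the term of row [i] in the estimator equals
    [penalty i / (1 + degree)]. *)
Definition weight (i : nat) : F :=
  penalty i / ((1 + degree) * bprod n (fun k => 1 - tilt i k * prob k)).
(* The derivative of the estimator in coordinate j, at the point whose other
   coordinates are z k for k < j and prob k for k > j. *)
Definition slope (z : nat -> F) (j : nat) : F :=
  c j - bsum m (fun i => weight i * (tilt i j *
    bprod n (fun k => if 0 < j%:R - k%:R :> F then 1 - tilt i k * z k
      else if 0 < k%:R - j%:R :> F then 1 - tilt i k * prob k else 1))).
(** Coordinates with [lam * fr j >= 1] are forced to 1; elsewhere the endpoint that lowers the
    estimator is taken. *)
Definition decide (z : nat -> F) (j : nat) : F :=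
  if 0 < 1 - lam * fr j then (if 0 < - slope z j then 1 else 0) else 1.

Fixpoint choices (k : nat) : nat -> F :=
  if k is k'.+1 then fun l => if l == k' then decide (choices k') k' else choices k' l
  else fun=> 0.

(** What row [i] still lacks after the choices [z], once the slack [eps * Ax i] has been granted. *)
Definition residual (z : nat -> F) (i : nat) : F :=
  bsum n (fun j => A i j * (fr j - z j)) - eps * Ax i.
Definition unused (z : nat -> F) (i j : nat) : F := if 0 < z j then 0 else A i j.
(** The greedy knapsack choice on the columns left at 0 by [z], with its order written out as sign
    tests that the machine can perform. *)
Definition repair (z : nat -> F) (i j : nat) : F :=
  if 0 < unused z i j then
    if 0 < residual z i - bsum n (fun k =>
      if 0 < c j / unused z i j - c k / unused z i k then unused z i k else
      if 0 < c k / unused z i k - c j / unused z i j then 0 else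
      if 0 < j%:R - k%:R :> F then unused z i k else 0)
    then 1 else 0
  else 0.
Definition up (z : nat -> F) (j : nat) : bool := 0 < z j + bsum m (fun i => repair z i j).
Definition rounded (z : nat -> F) (j : nat) : F := fl j + (if up z j then 1 else 0).

Hypotheses (eps_gt0 : 0 < eps) (eps_le1 : eps <= 1)
  (A0_ge0 : forall i j, (i < m)%N -> (j < n)%N -> 0 <= A0 i j)
  (c_ge0 : forall j, (j < n)%N -> 0 <= c j)
  (x_ge0 : forall j, (j < n)%N -> 0 <= x j).

#[local] Ltac slra := move: eps_gt0 eps_le1; lra.
#[local] Ltac snra := move: eps_gt0 eps_le1; nra.

(** * Elementary bounds on the computed quantities *)

Lemma fr_bounds j : 0 <= fr j < 1.
Proof.
have /andP[h1 h2] := floor_itv ((1 + eps) * x j).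
by move: h2; rewrite intrD /fr /fl subr_ge0 h1 /= ltrBlDl.
Qed.

Lemma fr_gt0_x j : (j < n)%N -> 0 < fr j -> 0 < x j.
Proof.
move=> jn fj; rewrite lt0r x_ge0 // andbT; apply/negP => /eqP xj.
by move: fj; rewrite /fr /fl xj !mulr0 floor0 subrr ltxx.
Qed.

Lemma A_ge0 i j : (i < m)%N -> (j < n)%N -> 0 <= A i j.
Proof. by move=> im jn; rewrite /A; case: ifP => // _; apply: A0_ge0. Qed.

Lemma A_le i j : (i < m)%N -> (j < n)%N -> A i j <= A0 i j.
Proof. by move=> im jn; rewrite /A; case: ifP => // _; apply: A0_ge0. Qed.

Lemma A_fr i j : A i j * fr j = A0 i j * fr j.
Proof.
rewrite /A; case: ltP => // h.
have -> : fr j = 0 by apply/eqP; rewrite eq_le h; have /andP[->] := fr_bounds j.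
by rewrite !mulr0.
Qed.

Lemma Ax_ge0 i : (i < m)%N -> 0 <= Ax i.
Proof.
move=> im; rewrite /Ax bsumE sumr_ge0 // => j _.
by rewrite mulr_ge0 ?A0_ge0 ?x_ge0.
Qed.

Lemma inv_width_ge0 : 0 <= inv_width.
Proof. exact: bmax_ge0. Qed.

(** Only [Ax i = 0] needs an argument, division by it being meaningless: there every column kept in
    [A] has [x j > 0], so its entry must vanish. *)
Lemma A_le_inv_width i j : (i < m)%N -> (j < n)%N -> A i j <= inv_width * Ax i.
Proof.
move=> im jn; have := Ax_ge0 im; rewrite le0r => /orP[/eqP h|h]; last first.
  rewrite -ler_pdivrMr //; apply: le_trans (le_bmax (fun j => A i j / Ax i) jn) _.
  exact: (le_bmax (fun i => bmax n (fun j => A i j / Ax i)) im).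
rewrite h mulr0 /A; case: ifP => // fj.
have xj := fr_gt0_x jn fj.
have : A0 i j * x j <= Ax i.
  rewrite /Ax bsumE (bigD1 (Ordinal jn)) //= lerDl sumr_ge0 // => k _.
  by rewrite mulr_ge0 ?A0_ge0 ?x_ge0.
by rewrite h pmulr_lle0.
Qed.

Lemma bsum_count (p : nat -> bool) k :
  bsum k (fun i => if p i then 1 else 0) = #|[pred i : 'I_k | p i]|%:R :> F.
Proof. by rewrite bsumE -big_mkcond /= sumr_const. Qed.

Lemma degree_nat K : (forall j, (j < n)%N -> (#|[pred i : 'I_m | (0 < A0 i j)%R]| <= K)%N) ->
  exists N : nat, [/\ degree = N%:R, (N <= m)%N & (N <= K)%N].
Proof.
move=> hK; rewrite /degree; case: (bmax_attained n
  (fun j => bsum m (fun i => if 0 < A i j then 1 else 0 : F))) => [->|[j jn ->]].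
  by exists 0%N.
rewrite bsum_count; exists #|[pred i : 'I_m | (0 < A i j)%R]|; split=> //.
  by rewrite -[X in (_ <= X)%N]card_ord max_card.
apply: leq_trans (hK j jn); apply: subset_leq_card; apply/fintype.subsetP => i.
rewrite !inE => h; apply: lt_le_trans h _; exact: A_le.
Qed.

Lemma harmonicE N : degree = N%:R -> (N <= m)%N ->
  degree_harmonic = \sum_(k < N) k.+1%:R^-1.
Proof.
move=> hd Nm; rewrite /degree_harmonic bsumE hd (big_ord_widen m (fun k => k.+1%:R^-1) Nm).
rewrite [RHS]big_mkcond /=; apply: eq_bigr => k _.
by rewrite subr_gt0 ltr_nat natr1.
Qed.

Lemma harmonic_ge0 : 0 <= degree_harmonic.
Proof.
rewrite /degree_harmonic bsumE sumr_ge0 // => k _; case: ifP => // _.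
Qed.

Lemma lam_ge1 : 1 <= lam.
Proof.
rewrite lerDl mulr_ge0 ?invr_ge0 ?mulr_ge0 ?harmonic_ge0 ?inv_width_ge0 //; exact: ltW.
Qed.

Lemma degree_ge1 i j : (i < m)%N -> (j < n)%N -> 0 < A i j -> 1 <= degree.
Proof.
move=> im jn Aij; apply: le_trans (le_bmax
  (fun j => bsum m (fun i => if 0 < A i j then 1 else 0 : F)) jn).
by rewrite bsumE (bigD1 (Ordinal im)) //= Aij lerDl sumr_ge0 // => k _; case: ifP.
Qed.

Lemma degree_ge0 : 0 <= degree. Proof. exact: bmax_ge0. Qed.

Lemma harmonic_ge1 : 1 <= degree -> 1 <= degree_harmonic.
Proof.
have [j jn|N [hd Nm _]] := @degree_nat m.
  by rewrite -[X in (_ <= X)%N]card_ord max_card.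
rewrite (harmonicE hd Nm) hd ler1n; case: N {hd Nm} => // N _.
by rewrite big_ord_recl /= invr1 lerDl sumr_ge0 // => k _; rewrite invr_ge0.
Qed.

Lemma prob_bounds j : 0 <= prob j <= 1.
Proof.
rewrite /prob; case: ltP => h; last by rewrite ler01 lexx.
have := lam_ge1; have /andP[f0 _] := fr_bounds j; move=> l1.
by rewrite mulr_ge0 //=; slra.
Qed.

Lemma prob_le j : prob j <= lam * fr j.
Proof. by rewrite /prob; case: ltP => h; slra. Qed.

Lemma tilt_bounds i j : (i < m)%N -> (j < n)%N -> 0 <= tilt i j <= eps / 8.
Proof.
move=> im jn; rewrite /tilt.
have h : A i j / Ax i <= inv_width.
  apply: le_trans (le_bmax (fun j => A i j / Ax i) jn) _.
  exact: (le_bmax (fun i => bmax n (fun j => A i j / Ax i)) im).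
have h0 : 0 <= A i j / Ax i by rewrite mulr_ge0 ?invr_ge0 ?A_ge0 ?Ax_ge0.
have e8 : 0 <= eps / 8 by slra.
rewrite mulr_ge0 ?(mulr_ge0 e8 h0) ?invr_ge0 ?inv_width_ge0 //=.
have := inv_width_ge0; rewrite le0r => /orP[/eqP->|w0].
  by rewrite invr0 mulr0.
by rewrite ler_pdivrMr // ler_wpM2l.
Qed.

Lemma factor_gt0 i j w : (i < m)%N -> (j < n)%N -> 0 <= w <= 1 -> 0 < 1 - tilt i j * w.
Proof. by move=> im jn /andP[w0 w1]; have /andP[] := tilt_bounds im jn; snra. Qed.

(** A row that still lacks something has a positive entry of [A], and [A_le_inv_width] then excludes
    zero factors. This licenses the later divisions. *)
Lemma residual_Ax_gt0 z i : (i < m)%N -> (forall j, (j < n)%N -> 0 <= z j) ->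
  0 < residual z i -> [/\ 0 < Ax i, 0 < inv_width & 1 <= degree].
Proof.
move=> im z0 hr.
have [j jn Aj] : exists2 j : nat, (j < n)%N & 0 < A i j.
  apply: contrapT => /forall2NP none; move: hr; rewrite /residual bsumE ltNge; case/negP.
  rewrite subr_le0; apply: le_trans (_ : 0 <= _); last first.
    by rewrite mulr_ge0 ?Ax_ge0 // ltW.
  apply: sumr_le0 => j _; have [//|/negP] := none j.
  rewrite -leNgt => h; have -> : A i j = 0 by apply/eqP; rewrite eq_le h A_ge0.
  by rewrite mul0r.
have := A_le_inv_width im jn; have := inv_width_ge0; have := Ax_ge0 im.
rewrite !le0r => /orP[/eqP->|->]; rewrite ?mulr0; first by slra.
move=> /orP[/eqP->|->]; rewrite ?mul0r; first by slra.
by move=> _; split=> //; apply: degree_ge1 Aj.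
Qed.

(** * Failed rows and their repair, for a 0/1 vector respecting the forced coordinates *)

Section Selection.
Variable z : nat -> F.
Hypotheses (z01 : forall j, (j < n)%N -> z j = 0 \/ z j = 1)
  (z_forced : forall j, (j < n)%N -> 1 <= lam * fr j -> z j = 1).

Lemma z_ge0 j : (j < n)%N -> 0 <= z j.
Proof. by move=> /z01[]->. Qed.

(** In a failed row the unforced mass [T] of [A fr] exceeds [X1], the chosen unforced mass, by more
    than [eps * Ax i], since forced columns already give at least their fractional part. Scaling by
    [lam] amplifies this gap to the harmonic sum required by [product_bound]. *)
Lemma chernoff i : product_bound F -> (i < m)%N -> 0 < residual z i ->
  (1 + degree) * \prod_(j < n) (1 - tilt i j * prob j) <= \prod_(j < n) (1 - tilt i j * z j).
Proof.
move=> pbF im hr.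
have [Ax0 w0 d1] := residual_Ax_gt0 im z_ge0 hr.
have [j jn|N [hd Nm _]] := @degree_nat m.
  by rewrite -[X in (_ <= X)%N]card_ord max_card.
rewrite hd; apply: pbF => //.
  move=> j jn; have /andP[t0 t1] := tilt_bounds im jn.
  split; [by rewrite t0 /=; slra|exact: prob_bounds|].
  by have [->|->] := z01 jn; rewrite ?lexx ?ler01.
rewrite -(harmonicE hd Nm).
pose kap := eps / 8 / (Ax i * inv_width).
have kap0 : 0 < kap by rewrite divr_gt0 ?mulr_gt0 // divr_gt0.
have tiltE j : tilt i j = kap * A i j by rewrite /tilt /kap; field; slra.
(* The 8 and the [eps] powers in [lam] are chosen to cancel those in [tilt]. *)
have lamE : degree_harmonic = (lam - 1) * eps * Ax i * kap by rewrite /lam /kap; field; slra.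
pose forced (j : 'I_n) := ~~ (0 < 1 - lam * fr j).
pose X0 := \sum_(j < n | forced j) A i j.
pose X1 := \sum_(j < n | ~~ forced j) A i j * z j.
pose Y0 := \sum_(j < n | forced j) A i j * fr j.
pose T := \sum_(j < n | ~~ forced j) A i j * fr j.
have Az : \sum_(j < n) A i j * z j = X0 + X1.
  rewrite (bigID forced) /=; congr (_ + _); apply: eq_bigr => j hj.
  by rewrite z_forced ?mulr1 //; move: hj; rewrite /forced -leNgt subr_le0.
have Ay : \sum_(j < n) A i j * fr j = Y0 + T by rewrite (bigID forced).
have Ap : \sum_(j < n) A i j * prob j = X0 + lam * T.
  rewrite (bigID forced) /= mulr_sumr; congr (_ + _); apply: eq_bigr => j.
    by rewrite /forced /prob => /negbTE->; rewrite mulr1.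
  by rewrite negbK /prob => ->; rewrite mulrCA.
have res : eps * Ax i < Y0 + T - (X0 + X1).
  move: hr; rewrite /residual bsumE subr_gt0 => /lt_le_trans; apply.
  by rewrite -Ay -Az -sumrB; apply: ler_sum => j _; rewrite mulrBr.
have YX : Y0 <= X0.
  apply: ler_sum => j _; rewrite -[leRHS]mulr1 ler_wpM2l ?A_ge0 //.
  by have /andP[_ /ltW] := fr_bounds j.
have X1p : 0 <= X1 by apply: sumr_ge0 => j _; rewrite mulr_ge0 ?A_ge0 ?z_ge0.
have X0p : 0 <= X0 by apply: sumr_ge0 => j _; rewrite A_ge0.
(* Each [fr j] is at most [(1 + eps) * x j], the floor being nonnegative. With [res] this gives
   [X0 + X1 <= Ax i]. *)
have Yt : Y0 + T <= (1 + eps) * Ax i.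
  rewrite -Ay /Ax bsumE mulr_sumr; apply: ler_sum => j _.
  rewrite A_fr mulrCA ler_wpM2l ?A0_ge0 // /fr lerBlDr lerDl /fl ler0z floor_ge0.
  by rewrite mulr_ge0 ?x_ge0 //; slra.
(* As [tilt i j <= eps / 8], the quadratic term contributes at most the relative error [eps / 4],
   which the slack [eps * Ax i] covers. *)
apply: le_trans (_ : degree_harmonic + (1 + eps / 4) * (kap * (X0 + X1)) <= _).
  rewrite lerD2l -Az !mulr_sumr; apply: ler_sum => j _.
  have /andP[t0 t1] := tilt_bounds im (ltn_ord j).
  have -> : (1 + eps / 4) * (kap * (A i j * z j)) = tilt i j * (1 + eps / 4) * z j.
    by rewrite tiltE; ring.
  rewrite ler_wpM2r ?z_ge0 //; snra.
have -> : \sum_(j < n) tilt i j * prob j = kap * (X0 + lam * T).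
  by rewrite -Ap mulr_sumr; apply: eq_bigr => j _; rewrite tiltE mulrA.
rewrite lamE.
have L0 : 0 <= lam - 1 by rewrite subr_ge0 lam_ge1.
have -> : (lam - 1) * eps * Ax i * kap + (1 + eps / 4) * (kap * (X0 + X1)) =
   kap * ((lam - 1) * (eps * Ax i) + (1 + eps / 4) * (X0 + X1)) by ring.
rewrite ler_pM2l //.
have h1 : (lam - 1) * (eps * Ax i) <= (lam - 1) * T by apply: ler_wpM2l => //; slra.
have h2 : eps * (X0 + X1) <= eps * Ax i by apply: ler_wpM2l; slra.
have eA : 0 < eps * Ax i by rewrite mulr_gt0.
have -> : (1 + eps / 4) * (X0 + X1) = (X0 + X1) + (eps * (X0 + X1)) / 4 by field.
have -> : lam * T = T + (lam - 1) * T by ring.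
slra.
Qed.

Lemma repairE i j : repair z i j = if picked n (unused z i) c (residual z i) j then 1 else 0.
Proof.
rewrite /repair /picked; case: ifP => //= _; rewrite subr_gt0 bsumE /prefix.
congr (if _ < _ then _ else _); apply: eq_bigr => k _.
by rewrite /before !subr_gt0 ltr_nat; case: ltgtP => //=; case: ifP.
Qed.

Lemma unused_ge0 i j : (i < m)%N -> (j < n)%N -> 0 <= unused z i j.
Proof. by move=> im jn; rewrite /unused; case: ifP => // _; apply: A_ge0. Qed.

Lemma repair_eq0 i j : (i < m)%N -> residual z i <= 0 -> repair z i j = 0.
Proof.
move=> im hr; rewrite repairE /picked; case: ifP => // /andP[_].
rewrite ltNge => /negP[]; apply: le_trans hr _.
by apply: sumr_ge0 => k _; case: ifP => // _; apply: unused_ge0.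
Qed.

Lemma row_repair i : (i < m)%N -> 0 < residual z i ->
  residual z i <= \sum_(j < n) unused z i j * repair z i j /\
  \sum_(j < n) c j * repair z i j <= penalty i.
Proof.
move=> im hr.
have [Ax0 w0 d1] := residual_Ax_gt0 im z_ge0 hr.
have e (f : nat -> F) : \sum_(j < n) f j * repair z i j =
    \sum_(j < n | picked n (unused z i) c (residual z i) j) f j.
  rewrite [RHS]big_mkcond; apply: eq_bigr => j _.
  by rewrite repairE; case: ifP; rewrite ?mulr1 ?mulr0.
have un_z j : (j < n)%N -> 0 < unused z i j -> [/\ unused z i j = A i j, z j = 0 & lam * fr j <= 1].
  move=> jn; rewrite /unused; case: (ltP 0 (z j)) => zj; first by rewrite ltxx.
  move=> _; split=> //.
    by apply/eqP; rewrite eq_le zj z_ge0.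
  by apply/ltW; rewrite ltNge; apply/negP => /(z_forced jn) z1; move: zj; rewrite z1; slra.
have hH := harmonic_ge1 d1.
(* The slack scaled by [lam] must exceed one largest entry [inv_width * Ax i], the overshoot of the
   greedy choice. *)
have lw : inv_width <= lam * eps.
  have -> : lam * eps = eps + 8 * (degree_harmonic * inv_width) / eps by rewrite /lam; field; slra.
  have : inv_width <= degree_harmonic * inv_width by rewrite ler_peMl // ltW.
  have : 8 * (degree_harmonic * inv_width) <= 8 * (degree_harmonic * inv_width) / eps.
    by rewrite ler_pdivlMr // ler_piMr // mulr_ge0 // mulr_ge0 // ltW //; slra.
  slra.
have [||||||g1 g2] := @knapsack_greedy F n (unused z i) c (fun j => lam * fr j)
  (residual z i) (inv_width * Ax i).
- move=> j jn; rewrite unused_ge0 //= /unused; case: ifP => _; last exact: A_le_inv_width.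
  by rewrite mulr_ge0 // ltW.
- exact: c_ge0.
- move=> j jn /(un_z j jn) [_ _ ->]; rewrite andbT mulr_ge0 //.
    by apply: le_trans lam_ge1.
  by have /andP[] := fr_bounds j.
- exact: hr.
- by rewrite mulr_ge0 // ltW.
- apply: le_trans (_ : lam * (residual z i + eps * Ax i) <= _).
    have := lam_ge1; move: hr; move: (residual z i) => r0 hr l1.
    have : r0 <= lam * r0 by rewrite ler_peMl // ltW.
    have : inv_width * Ax i <= lam * eps * Ax i by rewrite ler_pM2r.
    by rewrite mulrDr mulrA; slra.
  have -> : \sum_(j < n | 0 < unused z i j) unused z i j * (lam * fr j) =
      lam * \sum_(j < n) unused z i j * fr j.
    rewrite mulr_sumr big_mkcond; apply: eq_bigr => j _; case: ltP => h; first by rewrite mulrCA.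
    have -> : unused z i j = 0 by apply/eqP; rewrite eq_le h unused_ge0.
    by rewrite mul0r mulr0.
  rewrite ler_wpM2l //; first by apply: le_trans lam_ge1.
  (* Dropping the used columns only helps: each contributes [A i j * (fr j - 1) <= 0] to the
     residual. *)
  rewrite /residual subrK bsumE; apply: ler_sum => j _; rewrite /unused.
  have /andP[f0 f1] := fr_bounds j; have Aij := A_ge0 im (ltn_ord j).
  have [->|->] := z01 (ltn_ord j); first by rewrite ltxx subr0.
  by rewrite ltr01 mul0r mulr_ge0_le0 // subr_le0 ltW.
rewrite !e; split=> //; apply: le_trans g2 _.
rewrite /penalty bsumE mulr_sumr [leLHS]big_mkcond; apply: ler_sum => j _.
have p0 : 0 <= lam * (c j * fr j).
  by rewrite !mulr_ge0 ?c_ge0 //; [apply: le_trans lam_ge1|have /andP[] := fr_bounds j].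
case: ltP => [h|_]; last by case: ifP => // _; rewrite mulr0.
by have [<- _ _] := un_z j (ltn_ord j) h; rewrite h mulrCA.
Qed.

Lemma up_bounds j : (j < n)%N -> z j <= (if up z j then 1 else 0) <= z j + \sum_(i < m) repair z i j.
Proof.
move=> jn; rewrite /up bsumE.
have pk i : repair z i j = 0 \/ repair z i j = 1 by rewrite repairE; case: ifP; [right|left].
have s0 : 0 <= \sum_(i < m) repair z i j by apply: sumr_ge0 => i _; have [->|->] := pk i.
have [zj|zj] := z01 jn; rewrite zj; last by rewrite ltr_pwDl // lexx lerDl.
rewrite add0r; case: ltP => [h|_]; last by rewrite lexx s0.
rewrite ler01 /=; apply: contraTT h; rewrite -ltNge -leNgt => h.
apply: sumr_le0 => i _; have [->//|p1] := pk i; move: h.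
rewrite (bigD1 i) //= p1 ltNge lerDl => /negP[].
by apply: sumr_ge0 => k _; have [->|->] := pk k.
Qed.

Lemma up_cover i j : (i < m)%N -> (j < n)%N ->
  A i j * z j + unused z i j * repair z i j <= A i j * (if up z j then 1 else 0).
Proof.
move=> im jn; have Aij := A_ge0 im jn.
have pk k : repair z k j = 0 \/ repair z k j = 1 by rewrite repairE; case: ifP; [right|left].
have /andP[zu _] := up_bounds jn.
rewrite /unused; case: ltP => hz; first by rewrite mul0r addr0 ler_wpM2l.
have -> : z j = 0 by apply/eqP; rewrite eq_le hz z_ge0.
rewrite mulr0 add0r ler_wpM2l // /up.
have [->|pi] := pk i; first by case: ifP.
rewrite ifT ?pi // ltr_wpDl ?z_ge0 // bsumE (bigD1 (Ordinal im)) //= pi ltr_wpDr //.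
by apply: sumr_ge0 => k _; have [->|->] := pk k.
Qed.

(** [A0 fl + A fr] is [(1 + eps) * Ax i], so the unit steps need only supply [A fr - eps * Ax i].
    Either [z] does so alone, or the repair adds the missing residual. *)
Lemma rounded_covers i : (i < m)%N -> Ax i <= \sum_(j < n) A0 i j * rounded z j.
Proof.
move=> im.
have key : \sum_(j < n) A i j * fr j - eps * Ax i <= \sum_(j < n) A i j * (if up z j then 1 else 0).
  apply: le_trans (_ : \sum_(j < n) A i j * z j + \sum_(j < n) unused z i j * repair z i j <= _).
    have resE : residual z i = \sum_(j < n) A i j * fr j - \sum_(j < n) A i j * z j - eps * Ax i.
      by rewrite /residual bsumE -sumrB; congr (_ - _); apply: eq_bigr => j _; rewrite mulrBr.
    case: (ltP 0 (residual z i)) => hr.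
      by have [] := row_repair im hr; rewrite resE; slra.
    have : 0 <= \sum_(j < n) unused z i j * repair z i j.
      by apply: sumr_ge0 => j _; rewrite repair_eq0 ?mulr0.
    by move: hr; rewrite resE; slra.
  by rewrite -big_split; apply: ler_sum => j _; apply: up_cover.
apply: le_trans (_ : \sum_(j < n) A0 i j * fl j + \sum_(j < n) A i j * (if up z j then 1 else 0) <= _).
  have : \sum_(j < n) A0 i j * fl j + \sum_(j < n) A i j * fr j = (1 + eps) * Ax i.
    rewrite /Ax bsumE mulr_sumr -big_split; apply: eq_bigr => j _ /=.
    by rewrite A_fr /fr; ring.
  slra.
rewrite -big_split; apply: ler_sum => j _ /=; rewrite mulrDr lerD2l ler_wpM2r //.
  by case: ifP.
exact: A_le.
Qed.

(** A column raised by several failed rows is charged to each of them, so the repair costs simply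
    add up. *)
Lemma rounded_cost : \sum_(j < n) c j * rounded z j <=
  \sum_(j < n) c j * fl j + \sum_(j < n) c j * z j +
  \sum_(i < m) (if 0 < residual z i then penalty i else 0).
Proof.
apply: le_trans (_ : \sum_(j < n) (c j * fl j + c j * z j + c j * \sum_(i < m) repair z i j) <= _).
  apply: ler_sum => j _; rewrite /rounded !mulrDr -addrA lerD2l -mulrDr ler_wpM2l ?c_ge0 //.
  by have /andP[] := up_bounds (ltn_ord j).
rewrite !big_split /= lerD2l.
under eq_bigr do rewrite mulr_sumr.
rewrite exchange_big /=; apply: ler_sum => i _.
case: ltP => hr; first by have [] := row_repair (ltn_ord i) hr.
by rewrite big1 // => j _; rewrite repair_eq0 ?mulr0.
Qed.

End Selection.

(** * The pessimistic estimator and conditional expectations *)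

Definition potential (w : nat -> F) : F :=
  \sum_(j < n) c j * w j + \sum_(i < m) weight i * \prod_(k < n) (1 - tilt i k * w k).

Definition hybrid (z : nat -> F) (j k : nat) : F := if (k < j)%N then z k else prob k.

Lemma eq_potential w w' : (forall k, (k < n)%N -> w k = w' k) -> potential w = potential w'.
Proof.
move=> h; congr (_ + _); first by apply: eq_bigr => j _; rewrite h.
by apply: eq_bigr => i _; congr (_ * _); apply: eq_bigr => k _; rewrite h.
Qed.

Lemma slopeE z j (jn : (j < n)%N) :
  slope z j = c j - \sum_(i < m) weight i *
    (tilt i j * \prod_(k < n | k != Ordinal jn) (1 - tilt i k * hybrid z j k)).
Proof.
rewrite /slope bsumE; congr (_ - _); apply: eq_bigr => i _; congr (_ * (_ * _)).
rewrite bprodE (bigD1 (Ordinal jn)) //= ltrBrDr add0r ltxx mul1r.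
apply: eq_bigr => k kj; rewrite !subr_gt0 !ltr_nat /hybrid.
by case: ltngtP => // e; case/eqP: kj; apply: val_inj.
Qed.

(** The estimator is affine in each coordinate separately, so changing one coordinate moves it by
    the increment times the partial derivative. *)
Lemma potential_update w w' j (jn : (j < n)%N) :
  (forall k, (k < n)%N -> k != j -> w' k = w k) ->
  potential w' = potential w + (w' j - w j) * (c j - \sum_(i < m) weight i *
    (tilt i j * \prod_(k < n | k != Ordinal jn) (1 - tilt i k * w k))).
Proof.
move=> h; rewrite /potential [X in X + _ = _](bigD1 (Ordinal jn)) //=.
rewrite [X in _ = X + _ + _](bigD1 (Ordinal jn)) //=.
have e1 : \sum_(k < n | k != Ordinal jn) c k * w' k = \sum_(k < n | k != Ordinal jn) c k * w k.
  by apply: eq_bigr => k kj; rewrite h.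
pose Q i := \prod_(k < n | k != Ordinal jn) (1 - tilt i k * w k).
have e2 w2 : (forall k, (k < n)%N -> k != j -> w2 k = w k) ->
    \sum_(i < m) weight i * \prod_(k < n) (1 - tilt i k * w2 k) =
    \sum_(i < m) weight i * Q i - w2 j * \sum_(i < m) weight i * (tilt i j * Q i).
  move=> h2; rewrite mulr_sumr -sumrB; apply: eq_bigr => i _.
  rewrite (bigD1 (Ordinal jn)) //=.
  have -> : \prod_(k < n | k != Ordinal jn) (1 - tilt i k * w2 k) = Q i.
    by apply: eq_bigr => k kj; rewrite h2.
  by ring.
rewrite e1 (e2 w' h) (e2 w) //; ring.
Qed.

Lemma decide01 z j : decide z j = 0 \/ decide z j = 1.
Proof. by rewrite /decide; do 2?case: ifP; by [left|right]. Qed.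

Lemma choices01 k l : choices k l = 0 \/ choices k l = 1.
Proof.
elim: k => [|k IH] /=; first by left.
by case: eqP => // _; apply: decide01.
Qed.

Lemma choicesE k l : (l < k)%N -> choices k l = decide (choices l) l.
Proof.
elim: k => // k IH; rewrite ltnS leq_eqVlt /= => /orP[/eqP->|lk]; first by rewrite eqxx.
by rewrite IH // ltn_eqF.
Qed.

Lemma choices_forced j : (j < n)%N -> 1 <= lam * fr j -> choices n j = 1.
Proof. by move=> jn h; rewrite choicesE // /decide subr_gt0 ltNge h. Qed.

(** Coordinate [j] moves from [prob j] to the endpoint selected by the sign of [slope], which cannot
    raise an affine function. A forced coordinate does not move, its probability being 1. *)
Lemma decide_descent j : (j < n)%N ->
  potential (hybrid (choices j.+1) j.+1) <= potential (hybrid (choices j) j).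
Proof.
move=> jn; rewrite (@potential_update (hybrid (choices j) j) _ j jn); last first.
  move=> k kn kj; rewrite /hybrid /= (negbTE kj) ltnS leq_eqVlt (negbTE kj) //.
rewrite gerDl -slopeE /hybrid ltnn ltnSn /= eqxx.
have /andP[p0 p1] := prob_bounds j.
rewrite /decide; case: ifP => h; last first.
  by rewrite /prob h subrr mul0r.
case: ltP => hs; last by rewrite sub0r mulNr oppr_le0 mulr_ge0 //; move: hs; slra.
by rewrite mulr_ge0_le0 //; move: hs; slra.
Qed.

Lemma potential_choices : potential (choices n) <= potential prob.
Proof.
have h k : (k <= n)%N -> potential (hybrid (choices k) k) <= potential prob.
  elim: k => [|k IH] kn; first by rewrite (eq_potential (w' := prob)).
  by apply: le_trans (decide_descent kn) (IH (ltnW kn)).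
apply: le_trans (h n (leqnn n)); rewrite le_eqVlt; apply/orP; left; apply/eqP.
by apply: eq_potential => k kn; rewrite /hybrid kn.
Qed.

Lemma c_fr_ge0 j : (j < n)%N -> 0 <= c j * fr j.
Proof. by move=> jn; rewrite mulr_ge0 ?c_ge0 //; have /andP[] := fr_bounds j. Qed.

Lemma lam_gt0 : 0 < lam.
Proof. exact: lt_le_trans lam_ge1. Qed.

Lemma penalty_ge0 i : 0 <= penalty i.
Proof.
rewrite /penalty mulr_ge0 ?(ltW lam_gt0) // bsumE sumr_ge0 // => j _.
by case: ifP => // _; apply: c_fr_ge0.
Qed.

Lemma factors_gt0 i w : (i < m)%N -> (forall j, (j < n)%N -> 0 <= w j <= 1) ->
  0 < \prod_(k < n) (1 - tilt i k * w k).
Proof. by move=> im hw; apply: prodr_gt0 => k _; apply: factor_gt0 => //; apply: hw. Qed.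

(** Double counting: a column is charged once per row that it meets, hence at most [degree]
    times. *)
Lemma sum_penalty_le : \sum_(i < m) penalty i <= lam * (degree * \sum_(j < n) c j * fr j).
Proof.
rewrite /penalty -mulr_sumr ler_wpM2l ?(ltW lam_gt0) //.
under eq_bigr do rewrite bsumE.
rewrite exchange_big mulr_sumr; apply: ler_sum => j _ /=.
apply: le_trans (_ : bsum m (fun i => if 0 < A i j then 1 else 0) * (c j * fr j) <= _).
  rewrite bsumE mulr_suml; apply: ler_sum => i _.
  by case: ifP; rewrite ?mul1r ?mul0r.
rewrite ler_wpM2r ?c_fr_ge0 //.
exact: (le_bmax (fun j => bsum m (fun i => if 0 < A i j then 1 else 0 : F))).
Qed.

(** The linear part and the penalties contribute at most [lam * c fr] each; for the penalties, the
    normalisation of [weight] leaves the factor [degree / (1 + degree)]. *)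
Lemma potential_prob : potential prob <= 2 * lam * \sum_(j < n) c j * fr j.
Proof.
have d1 : 0 < 1 + degree by rewrite ltr_pwDl ?degree_ge0.
have s0 : 0 <= \sum_(j < n) c j * fr j by apply: sumr_ge0 => j _; apply: c_fr_ge0.
have -> : 2 * lam * \sum_(j < n) c j * fr j =
  lam * \sum_(j < n) c j * fr j + lam * \sum_(j < n) c j * fr j by ring.
apply: lerD.
  rewrite mulr_sumr; apply: ler_sum => j _; rewrite mulrCA ler_wpM2l ?c_ge0 //.
  exact: prob_le.
have -> : \sum_(i < m) weight i * \prod_(k < n) (1 - tilt i k * prob k) =
    (\sum_(i < m) penalty i) / (1 + degree).
  rewrite mulr_suml; apply: eq_bigr => i _; rewrite /weight bprodE.
  have := @factors_gt0 i prob (ltn_ord i) (fun j _ => prob_bounds j).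
  by move=> Q0; field; rewrite !gt_eqF.
rewrite ler_pdivrMr //; apply: le_trans sum_penalty_le _.
rewrite -mulrA ler_wpM2l ?(ltW lam_gt0) // [leRHS]mulrC ler_wpM2r //; slra.
Qed.

(** By [chernoff] the product of a failed row has grown by the factor [1 + degree] built into
    [weight], so its term is at least the full penalty. The terms of the other rows are
    nonnegative. *)
Lemma potential_ge : product_bound F ->
  \sum_(j < n) c j * choices n j +
    \sum_(i < m) (if 0 < residual (choices n) i then penalty i else 0) <=
  potential (choices n).
Proof.
move=> pbF; rewrite lerD2l; apply: ler_sum => i _.
have d1 : 0 < 1 + degree by rewrite ltr_pwDl ?degree_ge0.
have Q0 := @factors_gt0 i prob (ltn_ord i) (fun j _ => prob_bounds j).
have w0 : 0 <= weight i.
  by rewrite /weight bprodE divr_ge0 ?penalty_ge0 // ltW // mulr_gt0.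
case: ltP => hr; last first.
  rewrite mulr_ge0 // ltW // factors_gt0 // => j _.
  by have [->|->] := choices01 n j; rewrite ?lexx ?ler01.
have := chernoff (fun j _ => choices01 n j) choices_forced pbF (ltn_ord i) hr.
move=> /(ler_wpM2l w0); apply: le_trans.
by rewrite /weight bprodE divfK ?lexx // gt_eqF // mulr_gt0.
Qed.

(** * Bounds and cost of the rounded solution *)

Definition rounded_int (z : nat -> F) (j : nat) : int :=
  Num.floor ((1 + eps) * x j) + (if up z j then 1 else 0).

Lemma rounded_intE z j : (rounded_int z j)%:~R = rounded z j.
Proof. by rewrite /rounded_int /rounded intrD; case: up. Qed.

(** Such a column has zero entries in [A], so its slope is [c j >= 0] and no row picks it. This is
    what allows the ceiling in bound (3) rather than floor plus one. *)
Lemma up_fr0 j : (j < n)%N -> fr j = 0 -> up (choices n) j = false.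
Proof.
move=> jn fj.
have A0j i : A i j = 0 by rewrite /A fj ltxx.
have zj : choices n j = 0.
  rewrite choicesE // /decide fj mulr0 subr0 ltr01 /slope bsumE big1 => [|i _].
    by rewrite subr0 oppr_gt0 ltNge c_ge0.
  by rewrite /tilt A0j mul0r mulr0 mul0r mul0r mulr0.
rewrite /up zj add0r bsumE big1 ?ltxx // => i _.
by rewrite /repair /unused zj ltxx A0j ltxx.
Qed.

Lemma rounded_int_bounds j : (j < n)%N ->
  0 <= rounded_int (choices n) j <= Num.ceil ((1 + eps) * x j).
Proof.
move=> jn; have x0 : 0 <= (1 + eps) * x j.
  by rewrite mulr_ge0 ?x_ge0 //; slra.
apply/andP; split.
  by rewrite /rounded_int addr_ge0 ?floor_ge0 //; case: ifP.
rewrite /rounded_int ceil_floor lerD2l intrEfloor.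
have /andP[f0 _] := fr_bounds j.
case: eqP => /= h; first by rewrite up_fr0 // /fr /fl h subrr.
by case: ifP.
Qed.

(** The cost is at most [c fl + 2 * lam * c fr]. Since [lam >= 1], this is at most
    [2 * lam * (1 + eps) * c x], and [eps <= 1] turns it into the factor 4. *)
Lemma choices_cost : product_bound F ->
  \sum_(j < n) c j * rounded (choices n) j <= 4 * lam * \sum_(j < n) c j * x j.
Proof.
move=> pbF.
have h1 := rounded_cost (fun j _ => choices01 n j) choices_forced.
have h2 := potential_ge pbF.
have h3 := potential_choices; have h4 := potential_prob.
have h5 : \sum_(j < n) c j * fl j + \sum_(j < n) c j * fr j =
    (1 + eps) * \sum_(j < n) c j * x j.
  by rewrite mulr_sumr -big_split; apply: eq_bigr => j _ /=; rewrite /fr; ring.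
have l1 := lam_ge1.
have h6 : 0 <= \sum_(j < n) c j * fl j.
  apply: sumr_ge0 => j _; rewrite mulr_ge0 ?c_ge0 // /fl ler0z floor_ge0.
  by rewrite mulr_ge0 ?x_ge0 //; slra.
have h7 : 0 <= \sum_(j < n) c j * x j.
  by apply: sumr_ge0 => j _; rewrite mulr_ge0 ?c_ge0 ?x_ge0.
have h8 : \sum_(j < n) c j * fl j <= 2 * lam * \sum_(j < n) c j * fl j.
  by rewrite ler_peMl //; lra.
have h9 : (1 + eps) * \sum_(j < n) c j * x j <= 2 * \sum_(j < n) c j * x j.
  by rewrite ler_wpM2r //; slra.
have h10 : 2 * lam * ((1 + eps) * \sum_(j < n) c j * x j) <=
    2 * lam * (2 * \sum_(j < n) c j * x j).
  by rewrite ler_wpM2l //; lra.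
rewrite -h5 mulrDr in h10.
have h11 : 2 * lam * (2 * \sum_(j < n) c j * x j) = 4 * lam * \sum_(j < n) c j * x j by ring.
lra.
Qed.

Lemma inv_width_attained : inv_width = 0 \/
  exists i j, [/\ (i < m)%N, (j < n)%N, 0 < A0 i j & inv_width = A0 i j / Ax i].
Proof.
case: (bmax_attained m (fun i => bmax n (fun j => A i j / Ax i))) => [h|[i im h]]; first by left.
case: (bmax_attained n (fun j => A i j / Ax i)) => [h2|[j jn h2]].
  by left; rewrite /inv_width h.
have := A_ge0 im jn; rewrite le0r => /orP[/eqP Aij|Aij].
  by left; rewrite /inv_width h h2 Aij mul0r.
right; exists i, j; move: Aij h2; rewrite /A; case: ifP; rewrite ?ltxx // => _ h3 h4.
by split=> //; rewrite /inv_width h.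
Qed.

Lemma lam_le K :
  (forall j, (j < n)%N -> (#|[pred i : 'I_m | (0 < A0 i j)%R]| <= K)%N) ->
  lam <= 1 + 8 * ((\sum_(k < K) k.+1%:R^-1) * inv_width) / (eps * eps).
Proof.
move=> hK; have [N [hd Nm NK]] := degree_nat hK.
rewrite lerD2l ler_wpM2r ?invr_ge0 ?mulr_ge0 ?(ltW eps_gt0) // ler_wpM2l //.
rewrite ler_wpM2r ?inv_width_ge0 // (harmonicE hd Nm).
rewrite (big_ord_widen K (fun k => k.+1%:R^-1) NK) [leLHS]big_mkcond /=.
by apply: ler_sum => k _; case: ifP => // _; rewrite invr_ge0.
Qed.

End Algorithm.

(** * From the algorithm to the guarantee *)

(** The core of the guarantee without logarithms or extended reals, so that it can be proved over
    [rat] and mapped to the reals. The witness [w] stands for the reciprocal width. *)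
Definition certificate (F : archiRealFieldType) m n r (P : cpip F m n r) (eps : F)
    (xbar : 'cV[F]_n) (xhat : 'cV[int]_n) : Prop :=
  let xh : 'cV[F]_n := map_mx intr xhat in
  [/\ forall j, 0 <= xhat j 0 <= Num.ceil ((1 + eps) * xbar j 0),
      mxle (covmx P *m xbar) (covmx P *m xh) &
      exists w : F,
      (w = 0 \/ exists i j, 0 < covmx P i j /\ w = covmx P i j / (covmx P *m xbar) i 0) /\
      cost P xh <=
        4 * (1 + 8 * ((\sum_(k < dilation P) k.+1%:R^-1) * w) / (eps * eps)) * cost P xbar].

Section Certify.
Variables (F : archiRealFieldType) (m n r : nat) (P : cpip F m n r) (eps : F).
Variables (xbar : 'cV[F]_n) (fA : nat -> nat -> F) (fc fx : nat -> F).
Hypotheses (hA : forall (i : 'I_m) (j : 'I_n), fA i j = covmx P i j)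
  (hc : forall j : 'I_n, fc j = costs P j 0) (hx : forall j : 'I_n, fx j = xbar j 0).

Lemma costE (y : 'cV[F]_n) : cost P y = \sum_(j < n) fc j * y j 0.
Proof. by rewrite /cost mxE; apply: eq_bigr => j _; rewrite mxE hc. Qed.

Lemma covmxE (y : 'cV[F]_n) i : (covmx P *m y) i 0 = \sum_(j < n) fA i j * y j 0.
Proof. by rewrite mxE; apply: eq_bigr => j _; rewrite hA. Qed.

Lemma choices_certificate : product_bound F -> rounding_input P eps xbar ->
  certificate P eps xbar
    (\col_j rounded_int m n eps fA fc fx (choices m n eps fA fc fx n) j).
Proof.
move=> pbF [/andP[e0 e1] [A0' _ [_ _ c0' _]] [x0' _ _ _]].
have A0 i j : (i < m)%N -> (j < n)%N -> 0 <= fA i j.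
  by move=> im jn; have := A0' (Ordinal im) (Ordinal jn); rewrite mxE -hA.
have c0 j : (j < n)%N -> 0 <= fc j.
  by move=> jn; have := c0' (Ordinal jn) 0; rewrite mxE -hc.
have x0 j : (j < n)%N -> 0 <= fx j.
  by move=> jn; have := x0' (Ordinal jn) 0; rewrite mxE -hx.
have AxE i : Ax n fA fx i = \sum_(j < n) fA i j * xbar j 0.
  by rewrite /Ax bsumE; apply: eq_bigr => j _; rewrite hx.
set z := choices m n eps fA fc fx n.
set xhat := \col_j _.
have xhE (j : 'I_n) : (map_mx intr xhat : 'cV[F]_n) j 0 = rounded m n eps fA fc fx z j.
  by rewrite !mxE rounded_intE.
split=> [j|i k|].
- by rewrite mxE -hx; apply: rounded_int_bounds.
- rewrite ord1 !covmxE -AxE.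
  under [leRHS]eq_bigr do rewrite xhE.
  apply: rounded_covers => // j jn; first exact: choices01.
  exact: choices_forced.
exists (inv_width m n eps fA fx); split.
  have [->|[i [j [im jn Aij h]]]] : inv_width m n eps fA fx = 0 \/ exists i j,
      [/\ (i < m)%N, (j < n)%N, 0 < fA i j & inv_width m n eps fA fx = fA i j / Ax n fA fx i].
  - by apply: inv_width_attained.
  - by left.
  right.
  exists (Ordinal im), (Ordinal jn); rewrite -hA; split=> //.
  by rewrite h covmxE -AxE.
rewrite !costE.
under eq_bigr do rewrite xhE.
have -> : \sum_(j < n) fc j * xbar j 0 = \sum_(j < n) fc j * fx j.
  by apply: eq_bigr => j _; rewrite hx.
apply: le_trans (_ : 4 * lam m n eps fA fx * \sum_(j < n) fc j * fx j <= _).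
  by apply: choices_cost.
rewrite ler_wpM2r //; first by apply: sumr_ge0 => j _; rewrite mulr_ge0 ?c0 ?x0.
rewrite ler_wpM2l //; apply: lam_le => // j jn.
rewrite /dilation.
have := @leq_bigmax _ (fun j : 'I_n => #|[pred i | (0 < covmx P i j)%R]|) (Ordinal jn).
apply: leq_trans; apply: eq_leq; apply: eq_card => i.
by rewrite !inE -hA.
Qed.

End Certify.

(** * Transfer from the rationals to the reals *)

Lemma harmonic_sum_ge0 (F : realFieldType) (K : nat) : 0 <= \sum_(k < K) k.+1%:R^-1 :> F.
Proof. by apply: sumr_ge0 => k _; rewrite invr_ge0. Qed.

Lemma dilation_map (R : realType) m n r (P : cpip rat m n r) :
  dilation (map_cpip (@ratr R) P) = dilation P.
Proof.
by apply: eq_bigr => j _; apply: eq_card => i; rewrite !inE mxE ltr0q.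
Qed.

Lemma map_intr (R : realType) n (xhat : 'cV[int]_n) :
  map_mx intr xhat = map_mx (@ratr R) (map_mx intr xhat).
Proof. by apply/matrixP => i j; rewrite !mxE ratr_int. Qed.

Lemma cost_map (R : realType) m n r (P : cpip rat m n r) x :
  cost (map_cpip (@ratr R) P) (map_mx ratr x) = ratr (cost P x).
Proof. by rewrite /cost /= matrix.map_trmx -map_mxM mxE. Qed.

Lemma mxle_map (R : realType) p q (A B : 'M[rat]_(p, q)) :
  mxle A B -> mxle (map_mx (@ratr R) A) (map_mx ratr B).
Proof. by move=> h i j; rewrite !mxE ler_rat. Qed.

Lemma rounding_input_map (R : realType) m n r (P : cpip rat m n r) eps x :
  rounding_input P eps x ->
  rounding_input (map_cpip (@ratr R) P) (ratr eps) (map_mx ratr x).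
Proof.
move=> [/andP[e0 e1] [h1 h2 [h3 h4 h5 h6]] [g1 g2 g3 g4]].
have m0 p q (B : 'M[rat]_(p, q)) : mxle 0 B -> mxle 0 (map_mx (@ratr R) B).
  by move=> h; rewrite -(map_mx0 (@ratr R)); apply: mxle_map.
split; first by rewrite ltr0q e0 -(rmorph1 (@ratr R)) ler_rat.
  by split; [exact: m0..|split; exact: m0].
by split; rewrite /= -?map_mxM; [exact: m0|exact: mxle_map..].
Qed.

Lemma certificate_map (R : realType) m n r (P : cpip rat m n r) eps x xhat :
  certificate P eps x xhat ->
  certificate (map_cpip (@ratr R) P) (ratr eps) (map_mx ratr x) xhat.
Proof.
move=> [h1 h2 [w [hw hc]]]; split=> [j||].
- rewrite mxE -(rmorph1 (@ratr R)) -rmorphD -rmorphM ceil_rat; exact: h1.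
- by rewrite map_intr /= -!map_mxM; apply: mxle_map.
exists (ratr w); split.
  case: hw => [->|[i [j [Aij ->]]]]; [by left; rewrite rmorph0|right].
  by exists i, j; rewrite /= -map_mxM !mxE ltr0q fmorph_div.
rewrite map_intr !cost_map dilation_map.
have -> : \sum_(k < dilation P) k.+1%:R^-1 = ratr (\sum_(k < dilation P) k.+1%:R^-1) :> R.
  by rewrite rmorph_sum; apply: eq_bigr => k _; rewrite fmorphV rmorph_nat.
move: hc; rewrite -(ler_rat R); congr (_ <= _).
by rewrite !(rmorphM, fmorphV, rmorphD, rmorph1, rmorph_nat).
Qed.

(** * Width, logarithm and the final guarantee over the reals *)

Section Guarantee.
Variables (R : realType) (m n r : nat) (P : cpip R m n r) (eps : R) (xbar : 'cV[R]_n).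
Hypothesis inp : rounding_input P eps xbar.

Lemma width_le i j : 0 < covmx P i j ->
  (width P <= (covrhs P i 0 / covmx P i j)%:E)%E.
Proof.
move=> h; rewrite /width (bigD1 (i, j)) //= ge_min lexx //.
Qed.

Lemma width_cases : width P = +oo%E \/
  exists i j, 0 < covmx P i j /\ width P = (covrhs P i 0 / covmx P i j)%:E.
Proof.
rewrite /width; elim/big_ind: _ => [|x y hx hy|[i j] /= h]; first by left.
- by rewrite minElt; case: ifP.
- by right; exists i, j.
Qed.

Lemma cost_ge0 (y : 'cV[R]_n) : mxle 0 y -> 0 <= cost P y.
Proof.
have [_ [_ _ [_ _ c0 _]] _] := inp.
move=> y0; rewrite /cost mxE sumr_ge0 // => j _; rewrite mxE mulr_ge0 //.
  by have := c0 j 0; rewrite mxE.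
by have := y0 j 0; rewrite mxE.
Qed.

(** An infinite width leaves no positive entry, so [w = 0]; width zero makes the factor infinite, as
    the dilation is then at least 1. Otherwise [w] is at most the reciprocal width because
    [A xbar >= a], and 64 is 4 times 8 times the 2 of [harmonic_le_ln]. *)
Lemma certificate_factor w :
  (w = 0 \/ exists i j, 0 < covmx P i j /\ w = covmx P i j / (covmx P *m xbar) i 0) ->
  approx_factor 64 P eps = +oo%E \/
  exists2 f : R, approx_factor 64 P eps = f%:E &
    4 * (1 + 8 * ((\sum_(k < dilation P) k.+1%:R^-1) * w) / (eps * eps)) <= f.
Proof.
have [/andP[e0 e1] [A0 _ [a0 _ _ _]] [_ cov _ _]] := inp.
have L0 : 0 <= ln (1 + (dilation P)%:R) :> R by rewrite ln_ge0 // lerDl.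
have ee : 0 < eps ^+ 2 by rewrite exprn_gt0.
rewrite /approx_factor => hw.
case: width_cases => [Woo|[i [j [Aij W]]]].
  right; exists (64 * (1 + 0)).
    by rewrite Woo gt0_mulye ?lte_fin // invey mule0 -EFinD -EFinM.
  case: hw => [->|[i [j [Aij _]]]]; last by have := width_le Aij; rewrite Woo.
  by rewrite !(mulr0, mul0r) addr0; lra.
have Li : 0 < ln (1 + (dilation P)%:R) :> R.
  rewrite ln_gt0 // ltrDl ltr0n /dilation.
  have := @leq_bigmax _ (fun j : 'I_n => #|[pred i | (0 < covmx P i j)%R]|) j.
  apply: leq_trans.
  by apply/card_gt0P; exists i; rewrite inE.
have : 0 <= covrhs P i 0 / covmx P i j.
  by rewrite divr_ge0 ?(ltW Aij) //; have := a0 i 0; rewrite mxE.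
rewrite le0r => /orP[/eqP W0|W0].
  left; rewrite W W0 mul0e inve0 gt0_muley ?lte_fin //.
  by rewrite addey // gt0_muley // lte_fin.
right; set W1 := covrhs P i 0 / covmx P i j in W W0.
exists (64 * (1 + ln (1 + (dilation P)%:R) / (W1 * eps ^+ 2))).
  by rewrite W -EFinM inver (gt_eqF (mulr_gt0 W0 ee)).
have H := harmonic_le_ln R (dilation P).
have wW : w <= W1^-1.
  case: hw => [->|[i' [j' [Aij' ->]]]]; first by rewrite invr_ge0 ltW.
  have h1 := width_le Aij'; rewrite W lee_fin in h1.
  have h2 : 0 < covrhs P i' 0 / covmx P i' j' by apply: lt_le_trans h1.
  have h3 : 0 < covrhs P i' 0.
    by move: h2; rewrite pmulr_lgt0 ?invr_gt0.
  have h4 := cov i' 0.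
  apply: le_trans (_ : covmx P i' j' / covrhs P i' 0 <= _).
    by rewrite ler_pM2l // lef_pV2 ?posrE // (lt_le_trans h3).
  by rewrite -[covmx P i' j' / _]invf_div lef_pV2 ?posrE.
have H0 : 0 <= \sum_(k < dilation P) k.+1%:R^-1 :> R by apply: harmonic_sum_ge0.
have -> : 64 * (1 + ln (1 + (dilation P)%:R) / (W1 * eps ^+ 2)) =
   64 + 64 * (ln (1 + (dilation P)%:R) * W1^-1) / (eps * eps).
  by field; rewrite !gt_eqF.
have h : (\sum_(k < dilation P) k.+1%:R^-1) * w <= 2 * ln (1 + (dilation P)%:R) * W1^-1.
  apply: le_trans (_ : (\sum_(k < dilation P) k.+1%:R^-1) * W1^-1 <= _).
    by rewrite ler_wpM2l.
  by rewrite ler_wpM2r // invr_ge0 ltW.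
have i0 : 0 < (eps * eps)^-1 by rewrite invr_gt0 mulr_gt0.
have h5 : 4 * (8 * ((\sum_(k < dilation P) k.+1%:R^-1) * w)) / (eps * eps) <=
    64 * (ln (1 + (dilation P)%:R) * W1^-1) / (eps * eps).
  rewrite ler_pM2r //; lra.
lra.
Qed.

Lemma certificate_guarantee xhat :
  certificate P eps xbar xhat -> rounding_guarantee 64 P eps xbar xhat.
Proof.
have [/andP[e0 e1] [A0 B0 [a0 b0 c0 d0]] [x0 cov pack xd]] := inp.
move=> [h1 h2 [w [hw hc]]].
have xb j : 0 <= xbar j 0 by have := x0 j 0; rewrite mxE.
have cx := cost_ge0 x0.
have xh0 : mxle 0 (map_mx intr xhat : 'cV[R]_n).
  by move=> j k; rewrite ord1 !mxE ler0z; have /andP[] := h1 j.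
have e10 : 0 < 1 + eps by lra.
split; first by move=> j k; rewrite ord1 !mxE; have /andP[] := h1 j.
split.
- case: (certificate_factor hw) => [->|[f -> hf]]; last first.
    by rewrite -EFinM lee_fin; apply: le_trans hc _; rewrite ler_wpM2r.
  (* With an infinite factor and zero fractional cost the claimed bound is [+oo * 0 = 0]; the finite
     bound of the certificate still yields it. *)
  move: cx; rewrite le0r => /orP[/eqP cx0|cx0]; last first.
    by rewrite gt0_mulye ?lte_fin // leey.
  by rewrite cx0 mule0 lee_fin; move: hc; rewrite cx0 mulr0.
- by split.
- split=> j k; rewrite ord1 !mxE; first by have /andP[] := h1 j.
  by apply: le_ceil; rewrite ler_pM2l //; exact: xd.
- split=> i k; rewrite ord1.
    rewrite 3![in leRHS]mxE [leLHS]mxE [in leRHS]mxE mulr_sumr -big_split /=.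
    apply: ler_sum => j _; rewrite mxE.
    have Bij : 0 <= packmx P i j by have := B0 i j; rewrite mxE.
    have -> : (1 + eps) * (packmx P i j * xbar j 0) + packmx P i j =
        packmx P i j * ((1 + eps) * xbar j 0 + 1) by ring.
    rewrite ler_wpM2l //; have /andP[_ xc] := h1 j.
    apply: le_trans (_ : (Num.ceil ((1 + eps) * xbar j 0))%:~R <= _); first by rewrite ler_int.
    by apply/ltW; rewrite -ltrBlDr; have := ceilB1_lt ((1 + eps) * xbar j 0); rewrite intrB.
  by rewrite !mxE lerD2r ler_pM2l //; have := pack i 0; rewrite mxE.
Qed.

End Guarantee.

(** * The algorithm as a machine program *)

Lemma computable_natD dv a b : computable dv (fun s vs => (a s vs)%:R) ->
  computable dv (fun s vs => (b s vs)%:R) ->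
  computable dv (fun s vs => (a s vs + b s vs)%:R).
Proof.
move=> ha hb; apply: computable_ext (computable_add ha hb) _ => S s vs _.
by rewrite natrD.
Qed.

Lemma computable_natM dv a b : computable dv (fun s vs => (a s vs)%:R) ->
  computable dv (fun s vs => (b s vs)%:R) ->
  computable dv (fun s vs => (a s vs * b s vs)%:R).
Proof.
move=> ha hb; apply: computable_ext (computable_mul ha hb) _ => S s vs _.
by rewrite natrM.
Qed.

(** The length of the header and of the four blocks for [A], [a], [B] and [b]. *)
Definition cost_offset (s : ctx) : nat :=
  4 + (count_of 0 s * count_of 1 s + (count_of 0 s +
    (count_of 2 s * count_of 1 s + count_of 2 s))).
Definition cov_entry (s : ctx) (i j : nat) : rat := inp s (4 + (i * count_of 1 s + j)).
Definition cost_entry (s : ctx) (j : nat) : rat := inp s (cost_offset s + j).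
Definition frac_entry (s : ctx) (j : nat) : rat :=
  inp s (cost_offset s + (count_of 1 s + (count_of 1 s + j))).

(** Syntax-directed: each step matches the head of the expression with a closure lemma, and [lemmas]
    handles the named quantities shown computable before. *)
Ltac compute_step lemmas :=
  lazymatch goal with
  | |- computable ?d (fun _ _ => ?q) => exact (computable_const d q)
  | |- computable ?d (fun s vs => @Algebra.add _ (@?f s vs) (@?g s vs)) =>
      apply: (@computable_add d f g)
  | |- computable ?d (fun s vs => @GRing.mul _ (@?f s vs) (@?g s vs)) =>
      apply: (@computable_mul d f g)
  | |- computable ?d (fun s vs => @Algebra.opp _ (@?f s vs)) =>
      apply: (@computable_opp d f)
  | |- computable ?d (fun s vs => @GRing.inv _ (@?f s vs)) =>
      apply: (@computable_inv d f)
  | |- computable ?d (fun s vs => @intmul _ _ (Num.floor (@?f s vs))) =>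
      apply: (@computable_floor d f)
  | |- computable _ (fun s vs => if _ then _ else _) => apply: computable_if
  | |- computable ?d (fun s vs => bsum (count_of ?c s) (@?G s vs)) =>
      apply: (@computable_sum c d G); first by []
  | |- computable ?d (fun s vs => bprod (count_of ?c s) (@?G s vs)) =>
      apply: (@computable_prod c d G); first by []
  | |- computable ?d (fun s vs => bmax (count_of ?c s) (@?G s vs)) =>
      apply: (@computable_max c d G); first by []
  | |- computable ?d (fun s vs => inp s (@?a s vs)) => apply: (@computable_inp d a)
  | |- computable ?d (fun s vs => zval s (@?a s vs)) => apply: (@computable_zval d a)
  | |- computable ?d (fun s vs => @Algebra.natmul _ _ (count_of ?c s)) =>
      by apply: (@computable_count d c)
  | |- computable ?d (fun s vs => @Algebra.natmul _ _ (addn (@?a s vs) (@?b s vs))) =>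
      apply: (@computable_natD d a b)
  | |- computable ?d (fun s vs => @Algebra.natmul _ _ (muln (@?a s vs) (@?b s vs))) =>
      apply: (@computable_natM d a b)
  | |- computable _ (fun s vs => @Algebra.natmul _ _ _) =>
      match goal with
      | _ => exact: computable_var
      | _ => exact: (computable_weaken (computable_var _))
      | H : computable _ _ |- _ => exact: H
      | H : computable _ _ |- _ => exact: (computable_weaken H)
      | H : computable _ _ |- _ => exact: (computable_weaken (computable_weaken H))
      end
  | |- _ => lemmas
  end; cbv beta.

Section AlgorithmComputable.

Notation m s := (count_of 0 s).
Notation n s := (count_of 1 s).
Notation eps s := (inp s 3).
Notation nat_computable dv i := (computable dv (fun s vs => (i s vs)%:R)).

Ltac none := fail.

Lemma computable_cov_entry dv i j : nat_computable dv i -> nat_computable dv j ->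
  computable dv (fun s vs => cov_entry s (i s vs) (j s vs)).
Proof. by move=> hi hj; rewrite /cov_entry; do !compute_step none. Qed.

Lemma computable_cost_entry dv j : nat_computable dv j ->
  computable dv (fun s vs => cost_entry s (j s vs)).
Proof. by move=> hj; rewrite /cost_entry /cost_offset; do !compute_step none. Qed.

Lemma computable_frac_entry dv j : nat_computable dv j ->
  computable dv (fun s vs => frac_entry s (j s vs)).
Proof. by move=> hj; rewrite /frac_entry /cost_offset; do !compute_step none. Qed.

Lemma computable_fr dv j : nat_computable dv j ->
  computable dv (fun s vs => fr (eps s) (frac_entry s) (j s vs)).
Proof.
by move=> hj; rewrite /fr /fl; do !compute_step ltac:(simple apply computable_frac_entry).
Qed.

Lemma computable_A dv i j : nat_computable dv i -> nat_computable dv j ->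
  computable dv (fun s vs => A (eps s) (cov_entry s) (frac_entry s) (i s vs) (j s vs)).
Proof.
move=> hi hj; rewrite /A.
by do !compute_step ltac:(first [simple apply computable_fr | simple apply computable_cov_entry]).
Qed.

Lemma computable_Ax dv i : nat_computable dv i ->
  computable dv (fun s vs => Ax (n s) (cov_entry s) (frac_entry s) (i s vs)).
Proof.
move=> hi; rewrite /Ax.
by do !compute_step ltac:(first [simple apply computable_frac_entry | simple apply computable_cov_entry]).
Qed.

Lemma computable_inv_width dv :
  computable dv (fun s _ => inv_width (m s) (n s) (eps s) (cov_entry s) (frac_entry s)).
Proof.
rewrite /inv_width.
by do !compute_step ltac:(first [simple apply computable_A | simple apply computable_Ax]).
Qed.

Lemma computable_degree dv :
  computable dv (fun s _ => degree (m s) (n s) (eps s) (cov_entry s) (frac_entry s)).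
Proof. by rewrite /degree; do !compute_step ltac:(simple apply computable_A). Qed.

Lemma computable_lam dv :
  computable dv (fun s _ => lam (m s) (n s) (eps s) (cov_entry s) (frac_entry s)).
Proof.
rewrite /lam /degree_harmonic.
by do !compute_step ltac:(first [simple apply computable_inv_width | simple apply computable_degree]).
Qed.

Lemma computable_prob dv j : nat_computable dv j ->
  computable dv (fun s vs =>
    prob (m s) (n s) (eps s) (cov_entry s) (frac_entry s) (j s vs)).
Proof.
move=> hj; rewrite /prob.
by do !compute_step ltac:(first [simple apply computable_lam | simple apply computable_fr]).
Qed.

Lemma computable_tilt dv i j : nat_computable dv i -> nat_computable dv j ->
  computable dv (fun s vs =>
    tilt (m s) (n s) (eps s) (cov_entry s) (frac_entry s) (i s vs) (j s vs)).
Proof.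
move=> hi hj; rewrite /tilt.
by do !compute_step ltac:(first [simple apply computable_A | simple apply computable_Ax |
  simple apply computable_inv_width]).
Qed.

Lemma computable_weight dv i : nat_computable dv i ->
  computable dv (fun s vs => weight (m s) (n s) (eps s)
    (cov_entry s) (cost_entry s) (frac_entry s) (i s vs)).
Proof.
move=> hi; rewrite /weight /penalty.
by do !compute_step ltac:(first [simple apply computable_A | simple apply computable_lam |
  simple apply computable_degree | simple apply computable_tilt | simple apply computable_prob |
  simple apply computable_cost_entry | simple apply computable_fr]).
Qed.

Lemma computable_decide dv j : nat_computable dv j ->
  computable dv (fun s vs => decide (m s) (n s) (eps s)
    (cov_entry s) (cost_entry s) (frac_entry s) (zval s) (j s vs)).
Proof.
move=> hj; rewrite /decide /slope.
by do !compute_step ltac:(first [simple apply computable_weight | simple apply computable_lam |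
  simple apply computable_tilt | simple apply computable_prob | simple apply computable_cost_entry |
  simple apply computable_fr]).
Qed.

Lemma computable_unused dv i j : nat_computable dv i -> nat_computable dv j ->
  computable dv (fun s vs =>
    unused (eps s) (cov_entry s) (frac_entry s) (zval s) (i s vs) (j s vs)).
Proof. by move=> hi hj; rewrite /unused; do !compute_step ltac:(simple apply computable_A). Qed.

Lemma computable_repair dv i j : nat_computable dv i -> nat_computable dv j ->
  computable dv (fun s vs => repair (n s) (eps s)
    (cov_entry s) (cost_entry s) (frac_entry s) (zval s) (i s vs) (j s vs)).
Proof.
move=> hi hj; rewrite /repair /residual.
by do !compute_step ltac:(first [simple apply computable_unused | simple apply computable_A |
  simple apply computable_Ax | simple apply computable_cost_entry | simple apply computable_fr]).
Qed.

Lemma computable_rounded dv j : nat_computable dv j ->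
  computable dv (fun s vs => rounded (m s) (n s) (eps s)
    (cov_entry s) (cost_entry s) (frac_entry s) (zval s) (j s vs)).
Proof.
move=> hj; rewrite /rounded /up /fl.
by do !compute_step ltac:(first [simple apply computable_repair | simple apply computable_frac_entry]).
Qed.

End AlgorithmComputable.

(** * Layout of the input word *)

Lemma nth_allpairs (S T U : Type) (x0 : S) (y0 : T) (u0 : U) (f : S -> T -> U) s t i j :
  (i < size s)%N -> (j < size t)%N ->
  nth u0 [seq f x y | x <- s, y <- t] (i * size t + j) = f (nth x0 s i) (nth y0 t j).
Proof.
elim: s i => //= x s IH [|i] hi hj; rewrite nth_cat size_map.
  by rewrite hj (nth_map y0).
by rewrite mulSn -addnA ltnNge leq_addr /= addKn IH.
Qed.

Lemma size_mx_entries p q (M : 'M[rat]_(p, q)) : size (mx_entries M) = (p * q)%N.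
Proof. by rewrite size_allpairs !size_enum_ord. Qed.

Lemma nth_mx_entries p q (M : 'M[rat]_(p, q)) (i : 'I_p) (j : 'I_q) :
  nth 0 (mx_entries M) (i * q + j) = M i j.
Proof.
have := @nth_allpairs _ _ _ i j 0 (fun i j => M i j) (enum 'I_p) (enum 'I_q) i j.
by rewrite !size_enum_ord !nth_ord_enum; apply.
Qed.

Lemma nth_cat_size (T : Type) (x0 : T) s1 s2 k :
  nth x0 (s1 ++ s2) (size s1 + k) = nth x0 s2 k.
Proof. by rewrite nth_cat ltnNge leq_addr addKn. Qed.

Section Encoding.
Variables (m n r : nat) (P : cpip rat m n r) (eps : rat) (xbar : 'cV[rat]_n).

Notation word := (encode_input P eps xbar).

Definition input_ctx : ctx := Ctx (fun i => nth 0 word i) (fun=> 0).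

Lemma count_input : [/\ count_of 0 input_ctx = m, count_of 1 input_ctx = n &
  count_of 2 input_ctx = r].
Proof.
have num k : `|numq k%:R|%N = k by rewrite pmulrn numq_int.
by split; apply: num.
Qed.

Lemma input_cov_entry (i : 'I_m) (j : 'I_n) : cov_entry input_ctx i j = covmx P i j.
Proof.
have [_ n1 _] := count_input; rewrite /cov_entry n1.
rewrite -[LHS]/(nth 0 (mx_entries (covmx P) ++ _) (i * n + j)) nth_cat size_mx_entries.
rewrite ifT ?nth_mx_entries //.
by have := ltn_ord i; have := ltn_ord j; nia.
Qed.

Lemma input_cost_entry (j : 'I_n) : cost_entry input_ctx j = costs P j 0.
Proof.
have [n0 n1 n2] := count_input; rewrite /cost_entry /cost_offset n0 n1 n2.
have -> : (4 + (m * n + (m + (r * n + r))) + j =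
  4 + (m * n + (m * 1 + (r * n + (r * 1 + (j * 1 + 0))))))%N by lia.
rewrite -[LHS]/(nth 0 (mx_entries (covmx P) ++ _) _).
rewrite -(size_mx_entries (covmx P)) nth_cat_size.
rewrite -(size_mx_entries (covrhs P)) nth_cat_size.
rewrite -(size_mx_entries (packmx P)) nth_cat_size.
rewrite -(size_mx_entries (packrhs P)) nth_cat_size.
rewrite nth_cat size_mx_entries ifT; last by have := ltn_ord j; lia.
exact: (nth_mx_entries (costs P) j 0).
Qed.

Lemma input_frac_entry (j : 'I_n) : frac_entry input_ctx j = xbar j 0.
Proof.
have [n0 n1 n2] := count_input; rewrite /frac_entry /cost_offset n0 n1 n2.
have -> : (4 + (m * n + (m + (r * n + r))) + (n + (n + j)) =
  4 + (m * n + (m * 1 + (r * n + (r * 1 + (n * 1 + (n * 1 + (j * 1 + 0))))))))%N by lia.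
rewrite -[LHS]/(nth 0 (mx_entries (covmx P) ++ _) _).
rewrite -(size_mx_entries (covmx P)) nth_cat_size.
rewrite -(size_mx_entries (covrhs P)) nth_cat_size.
rewrite -(size_mx_entries (packmx P)) nth_cat_size.
rewrite -(size_mx_entries (packrhs P)) nth_cat_size.
rewrite -(size_mx_entries (costs P)) nth_cat_size size_mx_entries.
rewrite -(size_mx_entries (mults P)) nth_cat_size.
exact: (nth_mx_entries xbar j 0).
Qed.

Lemma rat_size_gt0 q : (0 < rat_size q)%N.
Proof. by []. Qed.

Lemma size_le_input_size (s : seq rat) : (size s <= input_size s)%N.
Proof.
rewrite /input_size -sum1_size; apply: leq_sum => q _; exact: rat_size_gt0.
Qed.

Lemma rat_size_le_input_size (s : seq rat) i : (i < size s)%N ->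
  (rat_size (nth 0%R s i) <= input_size s)%N.
Proof.
elim: s i => //= q s IH [|i] hi; rewrite /input_size big_cons /= ?leq_addr //.
by apply: leq_trans (IH i hi) _; rewrite leq_addl.
Qed.

(** The dimensions are bounded in value because the word lists [m] entries of [a], [r] of [b] and
    [n] of [c], each of size at least 1. *)
Lemma input_ctx_le : ctx_le (input_size word) input_ctx.
Proof.
have S2 : (2 <= input_size word)%N.
  apply: leq_trans (_ : rat_size m%:R <= _)%N; first by rewrite /rat_size /bitlen; lia.
  by rewrite /input_size /encode_input /= big_cons leq_addr.
have h0 : height_le (input_size word) 0 by apply: (@height_leW 1); rewrite // ltnW.
split=> [c c3|k|//].
- have sz : (m + n + r <= input_size word)%N.
    apply: leq_trans (size_le_input_size _).
    by rewrite /encode_input !size_cat !size_mx_entries /=; lia.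
  have [n0 n1 n2] := count_input.
  by case: c c3 => [|[|[|//]]] _; rewrite ?n0 ?n1 ?n2; split=> //; lia.
- case: (ltnP k (size word)) => hk; last by rewrite /= nth_default.
  exact/height_rat_size/rat_size_le_input_size.
Qed.

Lemma input_rep : env_rep input_ctx [::] [::] (load word).
Proof. by []. Qed.

End Encoding.

Definition decide_at (I : nat -> rat) (z : nat -> rat) (j : nat) : rat :=
  let s := Ctx I z in
  decide (count_of 0 s) (count_of 1 s) (inp s 3)
    (cov_entry s) (cost_entry s) (frac_entry s) (zval s) j.

Definition rounded_at (I : nat -> rat) (z : nat -> rat) (j : nat) : rat :=
  let s := Ctx I z in
  rounded (count_of 0 s) (count_of 1 s) (inp s 3)
    (cov_entry s) (cost_entry s) (frac_entry s) (zval s) j.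

(** The array pass of the machine, started from zeros, is the recursion [choices]. *)
Lemma zval_run_z s k : zval s = (fun=> 0) ->
  zval (run_z (fun s j => decide_at (inp s) (zval s) j) s k) =
  choices (count_of 0 s) (count_of 1 s) (inp s 3)
    (cov_entry s) (cost_entry s) (frac_entry s) k.
Proof.
move=> z0; elim: k => [|k IH]; first exact: z0.
by rewrite /= inp_run_z IH.
Qed.

Lemma rounding_program (R : realType) :
  exists (prog : cmd) (T : {poly nat}),
    forall (m n r : nat) (P : cpip rat m n r) (eps : rat) (xbar : 'cV[rat]_n),
      rounding_input P eps xbar ->
      exists (t : nat) (M : memory) (xhat : 'cV[int]_n),
        [/\ exec prog (load (encode_input P eps xbar)) t M,
            (t <= T.[input_size (encode_input P eps xbar)])%N,
            holds_output M xhat & certificate P eps xbar xhat].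
Proof.
have [|||p [tau [[c tauc] hp]]] := @run_program
  (fun s j => decide_at (inp s) (zval s) j) (fun s j => rounded_at (inp s) (zval s) j).
- exact: (computable_decide (computable_var 0)).
- exact: (computable_rounded (computable_var 0)).
- by move=> s j; apply: decide01.
exists p, (('X + 2%:P) ^+ c) => m n r P eps xbar inpP.
have [t [M [e et out]]] := hp _ _ _ (input_ctx_le P eps xbar) (input_rep P eps xbar).
have [n0 n1 n2] := count_input P eps xbar.
have cert := choices_certificate (input_cov_entry P eps xbar) (input_cost_entry P eps xbar)
  (input_frac_entry P eps xbar) (product_bound_rat R) inpP.
exists t, M; eexists; split; [exact: e| |move=> j|exact: cert].
- apply: leq_trans et _; apply: leq_trans (tauc _) _.
  by rewrite horner_exp hornerD hornerX hornerC.
- rewrite out ?n1 // inp_run_z zval_run_z // mxE rounded_intE n0 n1 /rounded_at.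
  rewrite /= -[count_of 0 (Ctx _ _)]/(count_of 0 (input_ctx P eps xbar)).
  by rewrite -[count_of 1 (Ctx _ _)]/(count_of 1 (input_ctx P eps xbar)) n0 n1.
Qed.

Theorem theorem6 (R : realType) :
  exists2 C : R, 0 < C &
    (forall (m n r : nat) (P : cpip R m n r) (eps : R) (xbar : 'cV[R]_n),
       rounding_input P eps xbar ->
       exists xhat : 'cV[int]_n, rounding_guarantee C P eps xbar xhat)
    /\
    (exists (prog : cmd) (T : {poly nat}),
       forall (m n r : nat) (P : cpip rat m n r) (eps : rat) (xbar : 'cV[rat]_n),
         rounding_input P eps xbar ->
         exists (t : nat) (M : memory) (xhat : 'cV[int]_n),
           [/\ exec prog (load (encode_input P eps xbar)) t M,
               (t <= T.[input_size (encode_input P eps xbar)])%N,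
               holds_output M xhat &
               rounding_guarantee C (map_cpip ratr P) (ratr eps)
                 (map_mx ratr xbar) xhat]).
Proof.
exists 64 => //; split=> [m n r P eps xbar inpP|].
  (* The algorithm is indexed by [nat]; matrices are extended by zero outside their range. *)
  pose ext p q (M : 'M[R]_(p, q)) (i j : nat) : R :=
    if insub i is Some i' then if insub j is Some j' then M i' j' else 0 else 0.
  have extE p q (M : 'M[R]_(p, q)) (i : 'I_p) (j : 'I_q) : ext _ _ M i j = M i j.
    by rewrite /ext !valK.
  have cert := @choices_certificate _ _ _ _ P eps xbar (ext _ _ (covmx P))
    (fun j => ext _ _ (costs P) j 0%N) (fun j => ext _ _ xbar j 0%N)
    (extE _ _ (covmx P)) (fun j => extE _ _ (costs P) j 0) (fun j => extE _ _ xbar j 0)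
    (@product_bound_real R) inpP.
  by eexists; apply: certificate_guarantee cert.
have [prog [T h]] := rounding_program R.
exists prog, T => m n r P eps xbar inpP.
have [t [M [xhat [e et out cert]]]] := h m n r P eps xbar inpP.
exists t, M, xhat; split=> //.
apply: certificate_guarantee; first exact: rounding_input_map.
exact: certificate_map.
Qed.
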